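(* Let $G$ be an infinite soluble group. Then $G$ is an $\mathfrak X$-group if and only if one of the following holds: (i) $G$ is cyclic; (ii) $G\cong\mathbb Z_{p^\infty}$ for some prime $p$; (iii) $G$ is dihedral (i.e. the infinite dihedral group); (iv) $G=A\langle y\rangle$ where $A\cong\mathbb Z_{2^\infty}$ and $\langle y\rangle$ has order $2$ or $4$, with $y^2\in A$ and $a^y=a^{-1}$ for all $a\in A$; (v) $G\cong A\rtimes D$, where, for some odd prime $p$, $A\cong\mathbb Z_{p^\infty}$ and $D\neq 1$ is a subgroup of the cyclic group $C_{p-1}$ of order $p-1$ consisting of the automorphisms of $A$ of finite order, acting naturally on $A$.
   Context: An $\mathfrak X$-group is a group in which every non-cyclic subgroup $H$ is self-centralizing, i.e. satisfies $C_G(H)\le H$. $\mathbb Z_{p^\infty}$ is the Prüfer $p$-group. $a^y=y^{-1}ay$. For $p$ odd, the automorphisms of finite order of $\mathbb Z_{p^\infty}$ form a cyclic group of order $p-1$. *)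

(* Defs.v *)
From HB Require Import structures.
From mathcomp Require Import all_boot all_order ssralg ssrnum ssrint algC.
From mathcomp Require Import boolp classical_sets functions cardinality.

Set Implicit Arguments.
Unset Strict Implicit.
Unset Printing Implicit Defensive.

Import GRing.Theory.

Local Open Scope classical_set_scope.
Local Open Scope group_scope.

Section Subgroups.
Variable G : groupType.
Implicit Types (H K : set G) (x y : G).

Definition is_subgroup H : Prop :=
  H 1 /\ (forall x y, H x -> H y -> H (x / y)).

Definition generated (X : set G) : set G := smallest is_subgroup X.

Definition is_cyclic H : Prop := exists x, H = generated [set x].

Definition centralizer H : set G := [set x | forall y, H y -> commute x y].

Definition frakX_group : Prop :=
  forall H, is_subgroup H -> ~ is_cyclic H -> centralizer H `<=` H.

Definition commutator_subgroup H K : set G :=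
  generated [set [~ x, y] | x in H & y in K].

Fixpoint derived (n : nat) : set G :=
  if n is m.+1 then commutator_subgroup (derived m) (derived m) else setT.

Definition soluble : Prop := exists n, derived n = [set 1].

Definition mul_set H K : set G := [set x * y | x in H & y in K].

End Subgroups.

(* Used for subgroups A and B only; the values of f outside A are irrelevant. *)
Definition isog (G K : groupType) (A : set G) (B : set K) : Prop :=
  exists f : G -> K,
    (forall x y, A x -> A y -> f (x * y) = f x * f y) /\ set_bij A B f.

Section Automorphisms.
Variable A : groupType.

Record aut := Aut {
  aut_fun :> A -> A;
  aut_inv : A -> A;
  autM : {morph aut_fun : x y / x * y};
  autK : cancel aut_fun aut_inv;
  autVK : cancel aut_inv aut_fun
}.

HB.instance Definition _ := gen_eqMixin aut.
HB.instance Definition _ := gen_choiceMixin aut.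

Lemma aut_ext (f g : aut) : f =1 g -> f = g.
Proof.
case: f g => [f f' fM fK f'K] [g g' gM gK g'K] /= /funext fg.
have fg' : f' = g' by apply/funext => x; rewrite -{1}[x]g'K -fg fK.
by case: _ / fg fg' gM gK g'K => <- *; congr Aut; apply: Prop_irrelevance.
Qed.

Lemma aut1M : {morph @id A : x y / x * y}. Proof. by []. Qed.

Definition aut1 : aut := @Aut id id aut1M (fun=> erefl) (fun=> erefl).

Lemma aut_compM (f g : aut) : {morph f \o g : x y / x * y}.
Proof. by move=> x y /=; rewrite !autM. Qed.

Definition aut_comp (f g : aut) : aut :=
  Aut (aut_compM f g) (can_comp (autK f) (autK g))
      (can_comp (autVK g) (autVK f)).

Lemma aut_invM (f : aut) : {morph aut_inv f : x y / x * y}.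
Proof. by move=> x y; apply: (can_inj (autK f)); rewrite autM !autVK. Qed.

Definition aut_opp (f : aut) : aut := Aut (aut_invM f) (autVK f) (autK f).

Lemma aut_compA : associative aut_comp.
Proof. by move=> f g h; apply: aut_ext. Qed.
Lemma aut_comp1f : left_id aut1 aut_comp.
Proof. by move=> f; apply: aut_ext. Qed.
Lemma aut_compf1 : right_id aut1 aut_comp.
Proof. by move=> f; apply: aut_ext. Qed.
Lemma aut_compVf : left_inverse aut1 aut_opp aut_comp.
Proof. by move=> f; apply: aut_ext => x; apply: autK. Qed.
Lemma aut_compfV : right_inverse aut1 aut_opp aut_comp.
Proof. by move=> f; apply: aut_ext => x; apply: autVK. Qed.

HB.instance Definition _ :=
  isGroup.Build aut aut_compA aut_comp1f aut_compf1 aut_compVf aut_compfV.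

End Automorphisms.

Definition finite_order_auts (A : groupType) : set (aut A) :=
  [set f | exists2 n, (0 < n)%N & f ^+ n = 1].

(* The holomorph A x| Aut A: Hol a f stands for a f, where f b f^-1 = f(b). *)
Section Holomorph.
Variable A : groupType.

Record holomorph := Hol { hol_base : A; hol_aut : aut A }.

HB.instance Definition _ := gen_eqMixin holomorph.
HB.instance Definition _ := gen_choiceMixin holomorph.

Implicit Types u v : holomorph.

Definition hol_one : holomorph := Hol 1 1.
Definition hol_mul u v : holomorph :=
  Hol (hol_base u * hol_aut u (hol_base v)) (hol_aut u * hol_aut v).
Definition hol_inv u : holomorph :=
  Hol ((hol_aut u)^-1 (hol_base u)^-1) (hol_aut u)^-1.

Lemma aut_fun1 (f : aut A) : f 1 = 1.
Proof. by apply: (@mulgI _ (f 1)); rewrite -autM !mulg1. Qed.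

Lemma hol_mulA : associative hol_mul.
Proof. by move=> u v w; rewrite /hol_mul /= autM !mulgA. Qed.
Lemma hol_mul1 : left_id hol_one hol_mul.
Proof. by case=> a f; rewrite /hol_mul /= !mul1g. Qed.
Lemma hol_mulr1 : right_id hol_one hol_mul.
Proof. by case=> a f; rewrite /hol_mul /= aut_fun1 !mulg1. Qed.
Lemma hol_mulV : left_inverse hol_one hol_inv hol_mul.
Proof.
case=> a f; rewrite /hol_mul /hol_inv /=; congr Hol; last exact: mulVg.
by rewrite -(autM f^-1) mulVg aut_fun1.
Qed.
Lemma hol_mulrV : right_inverse hol_one hol_inv hol_mul.
Proof.
case=> a f; rewrite /hol_mul /hol_inv /=; congr Hol; last exact: mulgV.
by rewrite [aut_fun f _]autVK mulgV.
Qed.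

HB.instance Definition _ :=
  isGroup.Build holomorph hol_mulA hol_mul1 hol_mulr1 hol_mulV hol_mulrV.

End Holomorph.

(* The semidirect product A x| D, D <= Aut A acting naturally, as a subgroup of
   the holomorph. *)
Definition sdprod_aut (A : groupType) (D : set (aut A)) : set (holomorph A) :=
  [set u | D (hol_aut u)].

Definition Zgroup : groupType := Algebra.to_multiplicative int.

Lemma Zgroup_invM : {morph (fun x : Zgroup => x^-1) : x y / x * y}.
Proof. exact: (@opprD int). Qed.

Definition Zgroup_inv : aut Zgroup :=
  Aut Zgroup_invM (@invgK Zgroup) (@invgK Zgroup).

Definition infinite_dihedral : set (holomorph Zgroup) :=
  sdprod_aut (generated [set Zgroup_inv]).

Section Prufer.
Variable p : nat.
Local Open Scope ring_scope.

(* The p-power roots of unity; z != 0 only matters for p = 0, where it makes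
   this a group as well. *)
Definition ppower_unity : pred algC :=
  fun z => (z != 0) && `[< exists n, z ^+ (p ^ n) = 1 >].

Record prufer := Prufer {
  prufer_val :> algC;
  pruferP : ppower_unity prufer_val
}.

HB.instance Definition _ := [isSub for prufer_val].
HB.instance Definition _ := [Choice of prufer by <:].

Lemma ppower_unity1 : ppower_unity 1.
Proof. by rewrite /ppower_unity oner_neq0; apply/asboolP; exists 0%N. Qed.

Lemma ppower_unityM z w :
  ppower_unity z -> ppower_unity w -> ppower_unity (z * w).
Proof.
move=> /andP[z0 /asboolP[m zm]] /andP[w0 /asboolP[n wn]].
apply/andP; split; first by rewrite mulf_neq0.
apply/asboolP; exists (m + n)%N.
by rewrite exprMn expnD exprM zm expr1n mul1r mulnC exprM wn expr1n.
Qed.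

Lemma ppower_unityV z : ppower_unity z -> ppower_unity z^-1.
Proof.
move=> /andP[z0 /asboolP[m zm]]; apply/andP; split; first by rewrite invr_eq0.
by apply/asboolP; exists m; rewrite exprVn zm invr1.
Qed.

Definition prufer_one := Prufer ppower_unity1.
Definition prufer_mul (z w : prufer) :=
  Prufer (ppower_unityM (pruferP z) (pruferP w)).
Definition prufer_inv (z : prufer) := Prufer (ppower_unityV (pruferP z)).

Lemma prufer_neq0 (z : prufer) : (z : algC) != 0.
Proof. by case/andP: (pruferP z). Qed.

Lemma prufer_mulA : associative prufer_mul.
Proof. by move=> x y z; apply: val_inj; rewrite /= mulrA. Qed.
Lemma prufer_mul1 : left_id prufer_one prufer_mul.
Proof. by move=> x; apply: val_inj; rewrite /= mul1r. Qed.
Lemma prufer_mulr1 : right_id prufer_one prufer_mul.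
Proof. by move=> x; apply: val_inj; rewrite /= mulr1. Qed.
Lemma prufer_mulV : left_inverse prufer_one prufer_inv prufer_mul.
Proof. by move=> x; apply: val_inj; rewrite /= mulVf ?prufer_neq0. Qed.
Lemma prufer_mulrV : right_inverse prufer_one prufer_inv prufer_mul.
Proof. by move=> x; apply: val_inj; rewrite /= divff ?prufer_neq0. Qed.

HB.instance Definition _ := isGroup.Build prufer
  prufer_mulA prufer_mul1 prufer_mulr1 prufer_mulV prufer_mulrV.

End Prufer.

(* Main.v *)
(* Let G be an infinite soluble group in which noncyclic subgroups are self-centralizing.
   A noncyclic subgroup of an abelian subgroup A must be A itself, so infinite abelian
   subgroups are infinite cyclic or Prufer groups.  An infinite subgroup K with finite derived
   subgroup is abelian: if x, y in K do not commute, H = C_K(x, y) is infinite, lies in the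
   noncyclic group <x, y>, hence is abelian; H is not noncyclic, since then x would lie in
   C(H) <= H, and an element of infinite order commutes with no nontrivial torsion element such
   as [x, y].  So the last infinite term of the derived series is abelian, and one gets an
   infinite abelian normal subgroup A with C(A) = A.
   If A is infinite cyclic, every element outside A inverts A.  If A is a p-Prufer group and g
   outside A centralizes its elements of order p, let c_m be the last generator of A fixed by g.
   Then g^p fixes c_(m+1), so <g^p, c_m> is cyclic, as otherwise it would contain c_(m+1); hence
   g acts with finite order, and the norm map 1 + g + ... + g^(q-1), which is zero or onto, shows
   that p = 2 and that g inverts A.  For p odd, all elements outside A therefore act without
   nontrivial fixed points, Aut(A) is abelian, and the centralizer of any such element is a
   complement of A. *)

From mathcomp Require Import all_boot all_order ssralg ssrnum ssrint poly zmodp.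
From mathcomp Require Import finalg intdiv algC cyclotomic fingroup cyclic.
From mathcomp Require Import boolp classical_sets functions cardinality zify.
Require Import Defs.

Set Implicit Arguments.
Unset Strict Implicit.
Unset Printing Implicit Defensive.

Import GRing.Theory Num.Theory.

Local Open Scope classical_set_scope.
Local Open Scope group_scope.

(** * Integer powers and cyclic subgroups *)

Section Subgroups.
Variable G : groupType.
Implicit Types (H K : set G) (x y g : G).

Section Closure.
Variables (H : set G) (sgH : is_subgroup H).

Lemma subg1 : H 1. Proof. by case: sgH. Qed.

Lemma subgV x : H x -> H x^-1.
Proof. by move=> Hx; rewrite -div1g; apply: sgH.2 => //; apply: subg1. Qed.

Lemma subgM x y : H x -> H y -> H (x * y).
Proof. by move=> Hx Hy; rewrite -[y]invgK; apply: sgH.2 => //; apply: subgV. Qed.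

Lemma subgX x n : H x -> H (x ^+ n).
Proof.
by move=> Hx; elim: n => [|n IHn]; rewrite ?expg0 ?expgS; [apply: subg1|apply: subgM].
Qed.

Lemma subgMl x y : H x -> H (x * y) -> H y.
Proof. by move=> Hx Hxy; rewrite -[y](mulKg x); apply: subgM => //; apply: subgV. Qed.

End Closure.

Lemma subgroupI H K : is_subgroup H -> is_subgroup K -> is_subgroup (H `&` K).
Proof.
move=> sgH sgK; split; first by split; apply: subg1.
by move=> x y [Hx Kx] [Hy Ky]; split; [apply: sgH.2|apply: sgK.2].
Qed.

Lemma generated_subgroup (X : set G) : is_subgroup (generated X).
Proof.
split=> [B [sgB _]|x y gx gy B [sgB sXB]]; first exact: subg1.
by apply: sgB.2; [apply: gx|apply: gy].
Qed.

Lemma sub_generated (X : set G) : X `<=` generated X.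
Proof. exact: sub_gen_smallest. Qed.

Lemma centralizer_subgroup H : is_subgroup (centralizer H).
Proof.
split=> [y _|x z Cx Cz y Hy]; first exact/commute_sym/commute1.
apply: commute_sym; apply: commuteM; first exact/commute_sym/Cx.
by apply: commuteV; apply/commute_sym/Cz.
Qed.

Lemma centralizer_generated (X : set G) g :
  (forall x, X x -> commute g x) -> centralizer (generated X) g.
Proof.
move=> gX x; apply: (smallest_sub (C := @is_subgroup G)); last exact: gX.
split=> [|u v gu gv]; first exact: commute1.
by apply: commuteM => //; apply: commuteV.
Qed.

Definition zpow x (k : int) : G :=
  match k with Posz n => x ^+ n | Negz n => x ^- n.+1 end.

Lemma zpowS x k : zpow x (k + 1)%R = zpow x k * x.
Proof.
case: k => [n|[|n]].
- have -> : (n%:Z + 1 = n.+1%:Z)%R by lia.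
  exact: expgSr.
- have -> : (Negz 0 + 1 = 0 :> int)%R by lia.
  by rewrite /= mulVg.
have -> : (Negz n.+1 + 1 = Negz n :> int)%R by lia.
by rewrite /= [in RHS]expgS invgM mulgVK.
Qed.

Lemma zpow0 x : zpow x 0%R = 1. Proof. by []. Qed.
Lemma zpow1 x : zpow x 1%R = x. Proof. by []. Qed.

Lemma zpow1n k : zpow (1 : G) k = 1.
Proof. by case: k => n /=; rewrite expg1n ?invg1. Qed.

(** The step is an equivalence, so that one cancellation in the group serves both signs of the
    exponent. *)
Lemma int_up_down (P : int -> Prop) :
  P 0%R -> (forall k, P k <-> P (k + 1)%R) -> forall k, P k.
Proof.
move=> P0 PS; case=> n.
  elim: n => [//|n IHn]; have := (PS n).1 IHn.
  by have -> : (n%:Z + 1 = n.+1%:Z)%R by lia.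
elim: n => [|n IHn]; apply/PS.
  by have -> : (Negz 0 + 1 = 0 :> int)%R by lia.
by have -> : (Negz n.+1 + 1 = Negz n :> int)%R by lia.
Qed.

Lemma zpowD x k l : zpow x (k + l)%R = zpow x k * zpow x l.
Proof.
elim/int_up_down: l => [|l]; first by rewrite addr0 zpow0 mulg1.
by rewrite addrA !zpowS mulgA; split=> [->//|/mulIg].
Qed.

Lemma zpowN x k : zpow x (- k)%R = (zpow x k)^-1.
Proof. by apply/esym/mulg1_eq; rewrite -zpowD subrr. Qed.

Lemma zpowB x k l : zpow x (k - l)%R = zpow x k / zpow x l.
Proof. by rewrite zpowD zpowN. Qed.

Lemma zpowM x k l : zpow x (k * l)%R = zpow (zpow x k) l.
Proof.
elim/int_up_down: l => [|l]; first by rewrite mulr0.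
by rewrite mulrDr mulr1 (zpowD x) zpowS; split=> [->//|/mulIg].
Qed.

Lemma zpowC x k l : commute (zpow x k) (zpow x l).
Proof. by rewrite /commute -!zpowD addrC. Qed.

Lemma commuteZ x y k : commute x y -> commute x (zpow y k).
Proof.
move=> cxy; case: k => n; first exact: commuteX.
by apply/commuteV/commuteX.
Qed.

Lemma commuteZ2 x y k l : commute x y -> commute (zpow x k) (zpow y l).
Proof. by move=> cxy; apply/commuteZ/commute_sym/commuteZ/commute_sym. Qed.

Lemma zpowJ x g k : zpow x k ^ g = zpow (x ^ g) k.
Proof. by case: k => n /=; rewrite ?conjVg conjXg. Qed.

Lemma subgZ H x k : is_subgroup H -> H x -> H (zpow x k).
Proof.
by move=> sgH Hx; case: k => n /=; [|apply: subgV => //]; apply: subgX.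
Qed.

Lemma zpow_range_subgroup x : is_subgroup (range (zpow x)).
Proof.
split=> [|_ _ [k _ <-] [l _ <-]]; first by exists 0%R.
by exists (k - l)%R; rewrite ?zpowB.
Qed.

Lemma generated1E x : generated [set x] = range (zpow x).
Proof.
apply/seteqP; split.
  apply: (smallest_sub (C := @is_subgroup G)); first exact: zpow_range_subgroup.
  by move=> _ ->; exists 1%R.
by move=> _ [k _ <-]; apply: (subgZ k (generated_subgroup _)); apply: sub_generated.
Qed.

Lemma is_cyclicP H : is_subgroup H ->
  is_cyclic H <-> exists2 x, H x & forall y, H y -> exists k, y = zpow x k.
Proof.
move=> sgH; split=> [[x ->]|[x Hx xH]].
  exists x => [|y]; first exact: sub_generated.
  by rewrite generated1E => -[k _ <-]; exists k.
exists x; rewrite generated1E; apply/seteqP; split=> [y /xH[k ->]|_ [k _ <-]].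
  by exists k.
exact: subgZ.
Qed.

(** Euclidean division by the least positive [d] with [x ^+ d] in [H]: a nonzero remainder would be
    a smaller such exponent. Without any such [d], negative powers are excluded too and [H] is
    trivial. *)
Lemma subgroup_of_cyclic H x :
  is_subgroup H -> H `<=` range (zpow x) -> is_cyclic H.
Proof.
move=> sgH Hx.
have [[n [n0 Hn]]|noH] := pselect (exists n, (0 < n)%N /\ H (x ^+ n)); last first.
  exists 1; rewrite generated1E; apply/seteqP; split=> [y Hy|_ [k _ <-]]; last first.
    by apply: subgZ => //; apply: subg1.
  case: (Hx y Hy) => -[[|k]|k] _ /= yE; first by exists 0%R; rewrite -?yE.
    by case: noH; exists k.+1; rewrite yE.
  by case: noH; exists k.+1; split=> //; rewrite -[x ^+ _]invgK yE; apply: subgV.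
have ex : exists n, (0 < n)%N && `[< H (x ^+ n) >].
  by exists n; rewrite n0; apply/asboolP.
case: (ex_minnP ex) => d /andP[d0 /asboolP Hd] dmin.
apply/is_cyclicP => //; exists (x ^+ d) => // y Hy.
have [k _ yE] := Hx y Hy; exists (k %/ d)%Z.
have kE := divz_eq k d.
have xr : H (zpow x (k %% d)%Z).
  apply: (subgMl sgH (subgZ (k %/ d)%Z sgH Hd)).
  by rewrite -[x ^+ d]/(zpow x d) -zpowM -zpowD mulrC -kE yE.
have r0 : (0 <= k %% d)%Z%R by rewrite modz_ge0 //; lia.
have rd : (k %% d < d)%Z%R by rewrite ltz_pmod.
move: xr kE r0 rd; case: (k %% d)%Z => [[|r]|r] xr kE r0 rd.
- by rewrite -[x ^+ d]/(zpow x d) -zpowM -yE [in LHS]kE addr0 mulrC.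
- have /dmin : (0 < r.+1)%N && `[< H (x ^+ r.+1) >] by apply/asboolP.
  lia.
- lia.
Qed.

End Subgroups.

(** * Prufer chains *)

Section Orders.
Variable G : groupType.
Implicit Types (H K A : set G) (x y g : G).

Definition infinite_order x := forall n, (0 < n)%N -> x ^+ n <> 1.

Lemma finite_orderP x : ~ infinite_order x <-> exists2 n, (0 < n)%N & x ^+ n = 1.
Proof.
split=> [|[n n0 xn] /(_ n n0)//].
by move=> /existsNP[n /not_implyP[n0 /contrapT xn]]; exists n.
Qed.

Lemma zpow_eq1 x k : infinite_order x -> zpow x k = 1 -> k = 0%R.
Proof.
move=> xinf; case: k => [[|n]|n] //=; first by move/xinf; case.
by move/eqP; rewrite invg_eq1 => /eqP/xinf; case.
Qed.

Lemma zpow_inj x : infinite_order x -> injective (zpow x).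
Proof.
move=> xinf k l kl; apply/eqP; rewrite -subr_eq0; apply/eqP/(zpow_eq1 xinf).
by rewrite zpowB kl mulgV.
Qed.

Lemma infinite_orderZ x k : infinite_order (zpow x k) -> infinite_order x.
Proof.
move=> xk n n0 xn; apply: (xk n n0).
by rewrite -[_ ^+ n]/(zpow _ n) -zpowM mulrC zpowM /= xn zpow1n.
Qed.

Lemma zpow_mod x n k : (0 < n)%N -> x ^+ n = 1 ->
  exists2 j, (j < n)%N & zpow x k = x ^+ j.
Proof.
move=> n0 xn.
have r0 : (0 <= k %% n)%Z%R by rewrite modz_ge0 //; lia.
have rd : (k %% n < n)%Z%R by rewrite ltz_pmod.
have kE := divz_eq k n; move: kE r0 rd; case: (k %% n)%Z => // r kE _ rd.
exists r; first by lia.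
by rewrite kE zpowD mulrC zpowM /= xn zpow1n mul1g.
Qed.

Lemma expg_gcd x m n : x ^+ m = 1 -> x ^+ n = 1 -> x ^+ gcdn m n = 1.
Proof.
case: (posnP m) => [->|m0] xm xn; first by rewrite gcd0n.
have [u v E _] := egcdnP n m0.
have : x ^+ (u * m) = 1 by rewrite mulnC expgnA xm expg1n.
by rewrite E expgnDr mulnC expgnA xn expg1n mul1g.
Qed.

Lemma expg_coprime x m n : coprime m n -> x ^+ m = 1 -> x ^+ n = 1 -> x = 1.
Proof. by move=> /eqP mn xm xn; rewrite -[x]expg1 -mn expg_gcd. Qed.

(** For commuting [x] and [y] this is the subgroup that they generate. *)
Definition prod2 x y : set G := [set g | exists k l, g = zpow x k * zpow y l].

Lemma prod2_subgroup x y : commute x y -> is_subgroup (prod2 x y).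
Proof.
move=> cxy; split=> [|_ _ [k [l ->]] [k' [l' ->]]].
  by exists 0%R, 0%R; rewrite mulg1.
exists (k - k')%R, (l - l')%R; rewrite !zpowB invgM -!mulgA; congr (_ * _).
rewrite !mulgA; have := commuteZ2 k' (l - l')%R cxy.
by move/commute_sym/commuteV; rewrite /commute zpowB => ->; rewrite !mulgA.
Qed.

Lemma prod2l x y k : prod2 x y (zpow x k).
Proof. by exists k, 0%R; rewrite mulg1. Qed.

Lemma prod2r x y k : prod2 x y (zpow y k).
Proof. by exists 0%R, k; rewrite mul1g. Qed.

Lemma prod2_sub x y H : is_subgroup H -> H x -> H y -> prod2 x y `<=` H.
Proof.
by move=> sgH Hx Hy _ [k [l ->]]; apply: subgM => //; apply: subgZ.
Qed.

Definition abelian_set A := forall x y, A x -> A y -> commute x y.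

Lemma prod2_abelian x y : commute x y -> abelian_set (prod2 x y).
Proof.
move=> cxy _ _ [k [l ->]] [k' [l' ->]].
have cc u v u' v' : commute (zpow x u * zpow y v) (zpow x u' * zpow y v').
  apply: commuteM; apply/commute_sym/commuteM; first exact: zpowC.
  - exact: commuteZ2.
  - exact/commute_sym/commuteZ2.
  - exact: zpowC.
exact: cc.
Qed.

Lemma finite_prod2 x y m n : (0 < m)%N -> (0 < n)%N -> x ^+ m = 1 -> y ^+ n = 1 ->
  finite_set (prod2 x y).
Proof.
move=> m0 n0 xm yn.
apply: (@sub_finite_set _ _ ((fun u : nat * nat => x ^+ u.1 * y ^+ u.2) @` (`I_m `*` `I_n))).
  move=> _ [k [l ->]].
  have [i im ->] := zpow_mod k m0 xm; have [j jn ->] := zpow_mod l n0 yn.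
  by exists (i, j).
by apply/finite_image/finite_setX; apply: finite_II.
Qed.

End Orders.

Section Chain.
Variables (G : groupType) (p : nat).
Implicit Types (c : nat -> G) (A K : set G) (x y g : G).

(** For [p] prime, [c n] has order [p ^ n], so a chain is a compatible system of generators of the
    finite layers of a Prufer group. *)
Definition is_chain c := [/\ c 0%N = 1, c 1%N <> 1 & forall n, c n.+1 ^+ p = c n].

Definition chain_union c : set G := [set x | exists n k, x = c n ^+ k].

Variables (c : nat -> G) (p_pr : prime p) (c_ch : is_chain c).
Let U := chain_union c.

Lemma chain0 : c 0%N = 1. Proof. by case: c_ch. Qed.
Lemma chainS n : c n.+1 ^+ p = c n. Proof. by case: c_ch. Qed.

Lemma chainX n m : c (n + m)%N ^+ (p ^ m) = c n.
Proof.
elim: m => [|m IHm]; first by rewrite addn0 expg1.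
by rewrite addnS expnS expgnA chainS.
Qed.

Lemma chain_le n m : (n <= m)%N -> c n = c m ^+ (p ^ (m - n)).
Proof. by move=> nm; rewrite -[in RHS](subnKC nm) addKn chainX. Qed.

(** If [c n.+1 ^+ k = 1], induction gives [k = j * p ^ n], so [c 1 ^+ j = 1]; as [c 1] has order
    [p], [p] divides [j]. *)
Lemma chain_order n k : c n ^+ k = 1 <-> (p ^ n %| k)%N.
Proof.
split=> [|/dvdnP[j ->]]; last first.
  by rewrite mulnC expgnA -[n in c n]add0n chainX chain0 expg1n.
elim: n k => [|n IHn] k ck; first by rewrite dvd1n.
have /IHn/dvdnP[j kE] : c n ^+ k = 1 by rewrite -chainS expgnAC ck expg1n.
rewrite kE expnS dvdn_pmul2r ?expn_gt0 ?prime_gt0 //.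
apply: contraT => pj; have cpj : coprime p j by rewrite prime_coprime.
case: c_ch => _ []; apply: (expg_coprime cpj); first by rewrite chainS chain0.
by rewrite -(chainX 1 n) -expgnA mulnC -kE add1n.
Qed.

Lemma chain_expV n : (c n)^-1 = c n ^+ (p ^ n).-1.
Proof.
apply: mulg1_eq; rewrite -expgS prednK ?expn_gt0 ?prime_gt0 //.
exact/chain_order.
Qed.

Lemma chain_common x y : U x -> U y -> exists n k l, x = c n ^+ k /\ y = c n ^+ l.
Proof.
move=> [n [k ->]] [m [l ->]].
exists (n + m)%N, (p ^ m * k)%N, (p ^ n * l)%N.
by rewrite !expgnA chainX addnC chainX.
Qed.

Lemma chain_abelian : abelian_set U.
Proof.
move=> x y Ux Uy; have [n [k [l [-> ->]]]] := chain_common Ux Uy.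
exact/commuteX2/commute_refl.
Qed.

Lemma chain_subgroup : is_subgroup U.
Proof.
split=> [|x y Ux Uy]; first by exists 0%N, 0%N.
have [n [k [l [-> ->]]]] := chain_common Ux Uy.
exists n, (k + (p ^ n).-1 * l)%N.
by rewrite expgnDr expgnA -chain_expV expVgn.
Qed.

Lemma chain_in n : U (c n).
Proof. by exists n, 1%N. Qed.

(** Strip factors [p] from the exponent, lowering [n]; an exponent prime to [p] is invertible modulo
    the order of [c n]. So each element of [U] generates the same cyclic group as some [c n]. *)
Lemma chain_generator x : U x ->
  exists n k l, x = c n ^+ k /\ c n = x ^+ l.
Proof.
case=> n [k ->]; elim: n k => [|n IHn] k.
  by exists 0%N, 0%N, 0%N; rewrite chain0 expg1n.
have [/dvdnP[j ->]|pk] := boolP (p %| k)%N.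
  by rewrite mulnC expgnA chainS; apply: IHn.
have k0 : (0 < k)%N by case: k pk => //; rewrite dvdn0.
have cpk : coprime k (p ^ n.+1) by rewrite coprimeXr // coprime_sym prime_coprime.
have [u v E _] := egcdnP (p ^ n.+1) k0.
exists n.+1, k, u; split=> //.
rewrite -expgnA mulnC E (eqP cpk) expgnDr mulnC expgnA.
by rewrite (iffRL (chain_order _ _)) // expg1n mul1g.
Qed.

Lemma chain_torsion x : U x -> exists2 n, (0 < n)%N & x ^+ n = 1.
Proof.
move=> [n [k ->]]; exists (p ^ n)%N; first by rewrite expn_gt0 prime_gt0.
by rewrite expgnAC (iffRL (chain_order _ _)) // expg1n.
Qed.

Lemma chain_layer n x : U x -> x ^+ (p ^ n) = 1 -> exists k, x = c n ^+ k.
Proof.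
move=> /chain_generator[m [k [l [xE cE]]]] xn.
have : c m ^+ (p ^ n) = 1 by rewrite cE expgnAC xn expg1n.
move/chain_order; rewrite dvdn_Pexp2l ?prime_gt1 // => mn.
by exists (p ^ (n - m) * k)%N; rewrite expgnA -chain_le.
Qed.

Lemma chain_bottom x : U x -> x <> 1 -> exists j, c 1%N = x ^+ j.
Proof.
move=> /chain_generator[[|n] [k [l [xE cE]]]] x1; first by rewrite xE chain0 expg1n in x1.
by exists (l * p ^ n)%N; rewrite expgnA -cE (chainX 1 n).
Qed.

(** An element of [K] generates the same group as some [c m], and [n <= m] would put [c n] in
    [K]. *)
Lemma chain_sub_layer K n : is_subgroup K -> K `<=` U -> ~ K (c n) ->
  forall x, K x -> exists k, x = c n ^+ k.
Proof.
move=> sgK KU Kn x Kx; have [m [k [l [xE cE]]]] := chain_generator (KU _ Kx).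
have [nm|mn] := leqP n m.
  by case: Kn; rewrite (chain_le nm) cE; apply: (subgX sgK); apply: (subgX sgK).
by exists (p ^ (n - m) * k)%N; rewrite expgnA -chain_le // ltnW.
Qed.

Lemma chain_full K : is_subgroup K -> K `<=` U -> (forall n, K (c n)) -> K = U.
Proof.
by move=> sgK KU Kc; apply/seteqP; split=> // _ [n [k ->]]; apply: (subgX sgK).
Qed.

Lemma chain_not_cyclic : ~ is_cyclic U.
Proof.
move/(is_cyclicP chain_subgroup) => [x [n [k ->]] xU].
have [j cE] := xU _ (chain_in n.+1).
have : zpow (c n.+1) (p ^ n)%N = 1.
  rewrite cE -zpowM mulrC zpowM /= expgnAC (iffRL (chain_order _ _)) //.
  by rewrite expg1n zpow1n.
move/chain_order; rewrite dvdn_Pexp2l ?prime_gt1 //; lia.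
Qed.

(** A subgroup missing some [c n] lies in the cyclic group [<c n>]. *)
Lemma chain_min_noncyclic K :
  is_subgroup K -> K `<=` U -> ~ is_cyclic K -> K = U.
Proof.
move=> sgK KU Knc; apply: chain_full => // n; apply: contrapT => Kn; case: Knc.
apply: (@subgroup_of_cyclic _ _ (c n)) => // x Kx.
by have [k ->] := chain_sub_layer sgK KU Kn Kx; exists k.
Qed.

(* A proper subgroup of U has finite exponent, whereas the image of U is divisible. *)
Lemma chain_endo_onto (phi : G -> G) :
  (forall x, U x -> U (phi x)) ->
  (forall x y, U x -> U y -> phi (x * y) = phi x * phi y) ->
  (exists2 x, U x & phi x <> 1) -> forall y, U y -> exists2 x, U x & phi x = y.
Proof.
move=> phiU phiM [x Ux phix].
have phi1 : phi 1 = 1.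
  by apply: (mulgI (phi 1)); rewrite -phiM ?mulg1 //; apply: subg1 chain_subgroup.
have phiX z k : U z -> phi (z ^+ k) = phi z ^+ k.
  move=> Uz; elim: k => [|k IHk]; first by rewrite !expg0.
  by rewrite !expgS phiM ?IHk //; apply: (subgX chain_subgroup).
pose I := [set y | exists2 x, U x & phi x = y].
have sgI : is_subgroup I.
  split=> [|_ _ [u Uu <-] [v Uv <-]]; first by exists 1 => //; apply: subg1 chain_subgroup.
  have Uv' : U v^-1 by apply: subgV => //; apply: chain_subgroup.
  exists (u / v); first exact: chain_subgroup.2.
  rewrite phiM //; congr (_ * _); apply/esym/mulg1_eq.
  by rewrite -phiM // mulgV.
have IU : I `<=` U by move=> _ [u Uu <-]; apply: phiU.
suff IE : I = U by move=> y Uy; have : I y by rewrite IE.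
apply: chain_full => // n; apply: contrapT => In; case: phix.
have [m [k ->]] := Ux; rewrite phiX; last exact: chain_in.
have -> : phi (c m) = phi (c (m + n)%N) ^+ (p ^ n) by rewrite -phiX ?chainX //; apply: chain_in.
have Ipc : I (phi (c (m + n)%N)) by exists (c (m + n)%N) => //; apply: chain_in.
have [j ->] := chain_sub_layer sgI IU In Ipc.
by rewrite (expgnAC (c n) j) (iffRL (chain_order _ _)) // !expg1n.
Qed.

End Chain.

(** A description internal to [G]; [is_prufer_isog] and [isog_is_prufer] relate it to the roots of
    unity [prufer p]. *)
Definition is_prufer (G : groupType) p (A : set G) :=
  prime p /\ exists2 c : nat -> G, is_chain p c & A = chain_union c.

(** * Infinite abelian groups whose proper subgroups are cyclic *)

Section MinimalNoncyclic.
Variables (G : groupType) (A : set G).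
Hypotheses (sgA : is_subgroup A) (cAA : abelian_set A) (A_inf : infinite_set A).
Hypotheses (A_nc : ~ is_cyclic A).
Hypothesis A_min :
  forall K, is_subgroup K -> K `<=` A -> ~ is_cyclic K -> K = A.

Lemma noncyclic_outside x : A x -> exists2 y, A y & forall k, y <> zpow x k.
Proof.
move=> Ax; apply: contrapT => noy; apply/A_nc/(is_cyclicP sgA); exists x => // y Ay.
apply: contrapT => yx; apply: noy; exists y => // k yk; apply: yx.
by exists k.
Qed.

Lemma min_noncyclic_prod2 x y : A x -> A y -> ~ is_cyclic (prod2 x y) -> A = prod2 x y.
Proof.
move=> Ax Ay nc; apply/esym/A_min => //; last exact: prod2_sub.
exact/prod2_subgroup/cAA.
Qed.

(** Otherwise minimality gives [A] exponent [q]. Take [x] nontrivial and [y] outside [<x>]: then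
    [<x, y>] is finite, and it is not cyclic because in a cyclic group of order [q] the element [x]
    would be a generator. So it is [A], which is infinite. *)
Lemma min_noncyclic_socle q : prime q -> is_cyclic [set x | A x /\ x ^+ q = 1].
Proof.
move=> q_pr; set Om := [set x | _]; have q0 := prime_gt0 q_pr.
have sgOm : is_subgroup Om.
  split=> [|x y [Ax xq] [Ay yq]]; first by split; [apply: subg1|rewrite expg1n].
  by split; [apply: sgA.2|rewrite expgnFl ?xq ?yq ?mulgV //; apply: cAA].
apply: contrapT => Om_nc; have OmA : Om = A by apply: A_min => // x [].
have Aq x : A x -> x ^+ q = 1 by rewrite -OmA => -[].
have [x Ax x1] := noncyclic_outside (subg1 sgA).
have [y Ay yx] := noncyclic_outside Ax.
have cxy := cAA Ax Ay.
apply: A_inf; rewrite (min_noncyclic_prod2 Ax Ay); first by apply: (finite_prod2 q0 q0); apply: Aq.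
move/(is_cyclicP (prod2_subgroup cxy)) => [z Kz zK].
have zq := Aq z (prod2_sub sgA Ax Ay Kz).
have [k xz] := zK _ (prod2l x y 1%R); have [l yz] := zK _ (prod2r x y 1%R).
have [i iq xzi] := zpow_mod k q0 zq.
have i0 : (0 < i)%N.
  by case: (i) xzi => // xzi; case: (x1 0%R); rewrite -[x]zpow1 xz xzi.
have cpi : coprime i q by rewrite coprime_sym prime_coprime // gtnNdvd.
have [u v E _] := egcdnP q i0.
case: (yx (u%:Z * l)%R); rewrite zpowM -[x]zpow1 xz xzi /= -expgnA mulnC E (eqP cpi).
by rewrite expgnDr mulnC expgnA zq expg1n mul1g -[y]zpow1.
Qed.

(* If A^q were proper, hence cyclic, A would be generated by an element w of order q and
   an element b of infinite order, and would properly contain the noncyclic <w, b^q>. *)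
Lemma min_noncyclic_divisible q x : prime q -> A x -> exists2 y, A y & y ^+ q = x.
Proof.
move=> q_pr Ax; have q0 := prime_gt0 q_pr; have q1 := prime_gt1 q_pr.
pose P := [set x | exists2 y, A y & y ^+ q = x].
have sgP : is_subgroup P.
  split=> [|_ _ [u Au <-] [v Av <-]].
    by exists 1; [apply: subg1|rewrite expg1n].
  by exists (u / v); [apply: sgA.2|apply/expgnFl/cAA].
have PA : P `<=` A by move=> _ [u Au <-]; apply: (subgX sgA).
have [Pc|/(A_min sgP PA) PE] := pselect (is_cyclic P); last by rewrite -PE in Ax.
move/(is_cyclicP sgP): Pc => [_ [b Ab <-] bP].
have := min_noncyclic_socle q_pr; set Om := [set x | _].
have sgOm : is_subgroup Om.
  split=> [|u v [Au uq] [Av vq]]; first by split; [apply: subg1|rewrite expg1n].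
  by split; [apply: sgA.2|rewrite expgnFl ?uq ?vq ?mulgV //; apply: cAA].
move/(is_cyclicP sgOm) => [w [Aw wq] wOm].
have cwb := cAA Aw Ab.
have AE : A `<=` prod2 w b.
  move=> a Aa; have [k ak] : exists k, a ^+ q = zpow (b ^+ q) k by apply: bP; exists a.
  have Abk := subgZ k sgA Ab.
  have [l al] : exists l, a / zpow b k = zpow w l.
    apply: wOm; split; first exact: sgA.2.
    rewrite expgnFl; last exact: cAA.
    rewrite ak -[_ ^+ q]/(zpow _ q) -[X in _ / X]/(zpow _ q) -!zpowM.
    by rewrite mulrC mulgV.
  by exists l, k; rewrite -al mulgVK.
have binf : infinite_order b.
  apply: contrapT => /finite_orderP[n n0 bn]; apply: A_inf.
  exact: (sub_finite_set AE (finite_prod2 q0 n0 wq bn)).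
have w1 : w <> 1.
  move=> w1; apply/A_nc/(is_cyclicP sgA); exists b => // a /AE[k [l ->]].
  by exists l; rewrite w1 zpow1n mul1g.
have cwbq : commute w (b ^+ q) by apply: commuteX.
have Abq : A (b ^+ q) by apply: (subgX sgA).
exfalso; have [Kc|Knc] := pselect (is_cyclic (prod2 w (b ^+ q))).
  (* [<z>] contains [b ^+ q], of infinite order, so it is torsion-free and cannot contain the
     torsion element [w]. *)
  move/(is_cyclicP (prod2_subgroup cwbq)): Kc => [z _ zK].
  have [k wz] := zK _ (prod2l w (b ^+ q) 1%R).
  have [l bz] := zK _ (prod2r w (b ^+ q) 1%R).
  have zinf : infinite_order z.
    apply: (infinite_orderZ (k := l)); rewrite -bz zpow1 => n n0; rewrite -expgnA.
    by apply: binf; rewrite muln_gt0 q0.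
  apply: w1; rewrite -[w]zpow1 wz.
  have /(zpow_eq1 zinf) : zpow z (k * q%:Z)%R = 1 by rewrite zpowM -wz.
  by move/eqP; rewrite mulf_eq0 => /orP[/eqP->//|]; lia.
have := Ab; rewrite (min_noncyclic_prod2 Aw Abq Knc) => -[k [l bE]].
(* The [q]-th power of [b = w ^ k * (b ^+ q) ^ l] loses [w], leaving [q = l * q * q] for the
   exponents of [b], whence [l * q = 1]. *)
have : zpow b (q%:Z - l * q%:Z * q%:Z)%R = 1.
  rewrite zpowB; apply/eqP; rewrite divg_eq1; apply/eqP.
  rewrite {1}/zpow {1}bE expgMn; last exact: commuteZ2.
  have -> : zpow w k ^+ q = 1.
    by rewrite -[_ ^+ q]/(zpow _ q) -zpowM mulrC zpowM /= wq zpow1n.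
  by rewrite mul1g -[_ ^+ q]/(zpow _ q) -[b ^+ q]/(zpow _ q) -!zpowM; congr zpow; lia.
move/(zpow_eq1 binf) => E.
have : (q%:Z * (1 - l * q%:Z) = 0)%R by rewrite mulrBr mulr1 [(q%:Z * (l * _))%R]mulrC; lia.
move/eqP; rewrite mulf_eq0 => /orP[|/eqP lq]; first by lia.
have : (l * q%:Z = 1)%R by lia.
have [l0|l0] : (l <= 0)%R \/ (1 <= l)%R by lia.
  nia.
nia.
Qed.

Lemma min_noncyclic_root q : prime q ->
  exists2 r : G -> G, (forall x, A x -> A (r x)) & (forall x, A x -> r x ^+ q = x).
Proof.
move=> q_pr.
have /choice[r rP] : forall x, exists y, A x -> A y /\ y ^+ q = x.
  move=> x; have [Ax|nAx] := pselect (A x); last by exists x.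
  by have [y Ay yx] := min_noncyclic_divisible q_pr Ax; exists y.
by exists r => x /rP[].
Qed.

(* The square roots of an element of infinite order would make A a copy of Z[1/2], in which
   3 is not invertible. *)
Lemma min_noncyclic_torsion x : A x -> ~ infinite_order x.
Proof.
move=> Ax xinf; have [r rA rK] := min_noncyclic_root (isT : prime 2).
pose s n := iter n r x.
have sA n : A (s n) by elim: n => //= n IHn; apply: rA.
have sS n : s n.+1 ^+ 2 = s n := rK _ (sA n).
have sX n m : s (n + m)%N ^+ (2 ^ m) = s n.
  elim: m => [|m IHm]; first by rewrite addn0 expg1.
  by rewrite addnS expnS expgnA sS.
have sinf n : infinite_order (s n).
  by apply: (infinite_orderZ (k := (2 ^ n)%N)); rewrite /= (sX 0%N).
pose S := [set y | exists n k, y = zpow (s n) k].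
have SA : S `<=` A by move=> _ [n [k ->]]; apply: subgZ.
have sgS : is_subgroup S.
  split=> [|_ _ [n [k ->]] [m [l ->]]]; first by exists 0%N, 0%R.
  exists (n + m)%N, ((2 ^ m)%N%:Z * k - (2 ^ n)%N%:Z * l)%R.
  rewrite zpowB !zpowM; congr (zpow _ k / zpow _ l); first by rewrite /= sX.
  by rewrite addnC /= sX.
have Snc : ~ is_cyclic S.
  move/(is_cyclicP sgS) => [z [n [k ->]] zS].
  have [|l sE] := zS (s n.+1); first by exists n.+1, 1%R.
  have : zpow (s n.+1) (2%:Z * (k * l))%R = zpow (s n.+1) 1%R.
    by rewrite zpowM [zpow _ 2%:Z]/= sS sE zpowM.
  by move/(zpow_inj (sinf _)); lia.
have [y Ay yx] := min_noncyclic_divisible (isT : prime 3) Ax.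
move: Ay; rewrite -(A_min sgS SA Snc) => -[n [k yE]].
have : zpow (s n) (k * 3%:Z)%R = zpow (s n) (2 ^ n)%N.
  by rewrite zpowM -yE /= yx (sX 0%N).
move/(zpow_inj (sinf _)) => E.
have /(congr1 (modn^~ 3)) : (3 * `|k|)%N = (2 ^ n)%N by lia.
rewrite mulnC modnMl => /esym/eqP.
by rewrite -[_ == _]/(3 %| 2 ^ n)%N Euclid_dvdX.
Qed.

(** [A] is torsion, so it has an element [z] of prime order [p]; iterated [p]-th roots of [z] form a
    chain, whose union is noncyclic and hence all of [A]. *)
Lemma min_noncyclic_prufer : exists p, is_prufer p A.
Proof.
have [x Ax x1] := noncyclic_outside (subg1 sgA).
have [n n0 xn] : exists2 n, (0 < n)%N & x ^+ n = 1.
  exact/finite_orderP/min_noncyclic_torsion.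
have ex : exists n, (0 < n)%N && (x ^+ n == 1) by exists n; rewrite n0 xn eqxx.
case: (ex_minnP ex) => d /andP[d0 /eqP xd] dmin.
have d1 : (1 < d)%N.
  by case: d d0 xd {dmin} => [|[|d]] // _ xd; case: (x1 0%R).
pose p := pdiv d; have p_pr : prime p := pdiv_prime d1.
have dE : d = (d %/ p * p)%N by rewrite divnK ?pdiv_dvd.
have dp0 : (0 < d %/ p)%N by lia.
pose z := x ^+ (d %/ p).
have zp : z ^+ p = 1 by rewrite -expgnA -dE.
have z1 : z <> 1.
  move=> z1; have := dmin (d %/ p)%N; rewrite dp0 -/z z1 eqxx => /(_ isT).
  by rewrite leqNgt ltn_Pdiv // prime_gt1.
have Az : A z by apply: (subgX sgA).
have [r rA rK] := min_noncyclic_root p_pr.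
(* The index is shifted by one: [c 0 = 1] and [c 1 = z]. *)
pose c n := if n is m.+1 then iter m r z else 1.
have cA m : A (c m) by case: m => [|m]; [apply: subg1|elim: m => //= m IHm; apply: rA].
have c_ch : is_chain p c.
  by split=> // -[//|m]; apply: rK; apply: (cA m.+1).
exists p; split=> //; exists c => //; apply/esym/A_min.
- exact: chain_subgroup p_pr c_ch.
- by move=> _ [m [k ->]]; apply: (subgX sgA).
- exact: chain_not_cyclic p_pr c_ch.
Qed.

End MinimalNoncyclic.

(** * Reduction to a self-centralizing abelian normal subgroup *)

Section FiniteSets.
Variable G : groupType.
Implicit Types (H K N A : set G) (x y g : G).

Lemma infinite_subgroup H x : is_subgroup H -> H x -> infinite_order x -> infinite_set H.
Proof.
move=> sgH Hx xinf Hfin; apply: infinite_nat.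
have xI : {in (fun n : nat => x ^+ n) @^-1` H &, injective (fun n : nat => x ^+ n)}.
  by move=> m n _ _ /= E; have /(zpow_inj xinf) [] : zpow x m = zpow x n by [].
by apply: sub_finite_set (finite_preimage xI Hfin) => n _ /=; apply: subgX.
Qed.

Lemma infinite_cyclic_generator H x :
  infinite_set H -> (forall y, H y -> exists k, y = zpow x k) -> infinite_order x.
Proof.
move=> Hinf xH; apply: contrapT => /finite_orderP[n n0 xn]; apply: Hinf.
apply: (@sub_finite_set _ _ ((fun k : nat => x ^+ k) @` `I_n)).
  by move=> y /xH[k ->]; have [j jn ->] := zpow_mod k n0 xn; exists j.
exact/finite_image/finite_II.
Qed.

(** Orbit-stabilizer: [K] is a union of cosets of the centralizer of [x] in [K], one for each
    conjugate of [x]. *)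
Lemma infinite_class_centralizer K x : is_subgroup K -> infinite_set K ->
  finite_set [set x ^ k | k in K] -> infinite_set (K `&` centralizer [set x]).
Proof.
move=> sgK Kinf cl_fin C_fin; apply: Kinf.
pose F y := [set k | K k /\ x ^ k = y].
apply: (@sub_finite_set _ _ (\bigcup_(y in [set x ^ k | k in K]) F y)).
  by move=> k Kk; exists (x ^ k) => //; exists k.
apply: bigcup_finite => // _ [k Kk <-].
apply: (@sub_finite_set _ _ ((fun c => c * k) @` (K `&` centralizer [set x]))); last first.
  exact: finite_image.
move=> l [Kl xlk]; exists (l / k); last by rewrite mulgVK.
split=> [|_ ->]; first exact: sgK.2.
apply/commute_sym/commgP; rewrite -conjg_fix conjgM xlk -conjgM mulgV conjg1 //.
Qed.

End FiniteSets.

Definition normal_set (G : groupType) (A : set G) := forall x g, A x -> A (x ^ g).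

Section Derived.
Variable G : groupType.

Lemma derived_subgroup n : is_subgroup (@derived G n).
Proof. by case: n => [|n]; [split|apply: generated_subgroup]. Qed.

Lemma derivedR n (x y : G) : derived n x -> derived n y -> derived n.+1 [~ x, y].
Proof. by move=> Dx Dy; apply: sub_generated; exists x => //; exists y. Qed.

Lemma derived_normal n : normal_set (@derived G n).
Proof.
elim: n => [//|n IHn] x g Dx.
suff /(_ x Dx): derived n.+1 `<=` [set x : G | derived n.+1 (x ^ g)] by [].
have sgD := derived_subgroup n.+1.
apply: (smallest_sub (C := @is_subgroup G)).
  split=> [|u v Du Dv] /=; first by rewrite conj1g; apply: subg1.
  by rewrite conjMg conjVg; apply: sgD.2.
move=> _ [u Du [v Dv <-]] /=; rewrite conjRg; apply: derivedR; exact: IHn.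
Qed.

End Derived.

(** * Abelian subgroups and centralizers in an $\mathfrak X$-group *)

Section FrakX.
Variable G : groupType.
Hypothesis XG : frakX_group G.
Implicit Types (H K N A : set G) (x y g h t : G).

(** [A] centralizes each of its subgroups, so a noncyclic one must contain [A]. *)
Lemma frakX_abelian A K : abelian_set A -> is_subgroup K -> K `<=` A ->
  ~ is_cyclic K -> K = A.
Proof.
move=> cAA sgK KA Knc; apply/seteqP; split=> // x Ax.
by apply: (XG sgK Knc) => y Ky; apply: cAA => //; apply: KA.
Qed.

Lemma frakX_abelian_infinite A : is_subgroup A -> abelian_set A -> infinite_set A ->
  ~ is_cyclic A -> exists p, is_prufer p A.
Proof.
move=> sgA cAA Ainf Anc; apply: min_noncyclic_prufer => // K sgK KA Knc.
exact: frakX_abelian.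
Qed.

(** The infinite abelian group [<h, t>] is cyclic, since otherwise it would be a Prufer group, which
    has no element of infinite order. *)
Lemma frakX_commute_infinite_order h t : infinite_order h -> commute h t ->
  exists z i j, h = zpow z i /\ t = zpow z j.
Proof.
move=> hinf cht; have sgP := prod2_subgroup cht.
have hP : prod2 h t h by apply: (prod2l h t 1%R).
have tP : prod2 h t t by apply: (prod2r h t 1%R).
have [/(is_cyclicP sgP)[z _ zP]|Pnc] := pselect (is_cyclic (prod2 h t)).
  by have [i hE] := zP h hP; have [j tE] := zP t tP; exists z, i, j.
have [||p [p_pr [c c_ch PE]]] := frakX_abelian_infinite sgP _ _ Pnc.
- exact: prod2_abelian.
- exact: infinite_subgroup hinf.
by move: hP; rewrite PE => /(chain_torsion p_pr c_ch)/finite_orderP.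
Qed.

Lemma frakX_commute_torsion h t n : infinite_order h -> commute h t ->
  (0 < n)%N -> t ^+ n = 1 -> t = 1.
Proof.
move=> hinf cht n0 tn.
have [z [i [j [hE tE]]]] := frakX_commute_infinite_order hinf cht.
have zinf : infinite_order z by apply: (infinite_orderZ (k := i)); rewrite -hE.
have /(zpow_eq1 zinf)/eqP : zpow z (j * n%:Z)%R = 1 by rewrite zpowM -tE.
by rewrite mulf_eq0 tE => /orP[/eqP->//|]; lia.
Qed.

Lemma frakX_commute_power h t : infinite_order h -> commute h t ->
  exists n k, (0 < n)%N /\ t ^+ n = zpow h k.
Proof.
move=> hinf cht.
have [z [i [j [hE tE]]]] := frakX_commute_infinite_order hinf cht.
have i0 : i <> 0%R by move=> i0; case: (hinf 1%N isT); rewrite hE i0.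
have E : zpow t i = zpow h j by rewrite hE tE -!zpowM mulrC.
case: i i0 E {hE} => [n|n] i0 E; first by exists n, j; split; [lia|].
by exists n.+1, (- j)%R; split=> //; rewrite zpowN -E /= invgK.
Qed.

Lemma frakX_finite_derived_abelian K N : is_subgroup K -> infinite_set K ->
  is_subgroup N -> finite_set N -> (forall x y, K x -> K y -> N [~ x, y]) ->
  abelian_set K.
Proof.
move=> sgK Kinf sgN Nfin KN x y Kx Ky; apply: contrapT => ncxy.
(* The conjugates of [z] under [K] lie in the finite coset [z N]. *)
have cl_fin z : K z -> finite_set [set z ^ k | k in K].
  move=> Kz; apply: (@sub_finite_set _ _ ((fun n => z * n) @` N)); last exact: finite_image.
  by move=> _ [k Kk <-]; exists [~ z, k]; [apply: KN|rewrite commgEl mulVKg].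
pose H1 := K `&` centralizer [set x].
have sgH1 : is_subgroup H1 by apply/subgroupI => //; apply: centralizer_subgroup.
have H1inf : infinite_set H1 by apply: infinite_class_centralizer => //; apply: cl_fin.
pose H := H1 `&` centralizer [set y].
have sgH : is_subgroup H by apply/subgroupI => //; apply: centralizer_subgroup.
have Hinf : infinite_set H.
  apply: infinite_class_centralizer => //; apply: sub_finite_set (cl_fin y Ky).
  by move=> _ [k [Kk _] <-]; exists k.
pose L := generated [set x; y].
have Lx : L x by apply: sub_generated; left.
have Ly : L y by apply: sub_generated; right.
have sgL : is_subgroup L := generated_subgroup _.
have HCL : H `<=` centralizer L.
  move=> h [[_ hx] hy]; apply: centralizer_generated => _ [->|->]; [exact: hx|exact: hy].
have Lnc : ~ is_cyclic L.
  move=> /(is_cyclicP sgL)[z _ zL]; apply: ncxy.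
  by have [i ->] := zL x Lx; have [j ->] := zL y Ly; apply: zpowC.
have HL : H `<=` L by move=> h Hh; apply: (XG sgL Lnc); apply: HCL.
have [/(is_cyclicP sgH)[h Hh hH]|Hnc] := pselect (is_cyclic H).
  have hinf := infinite_cyclic_generator Hinf hH.
  have [n n0 tn] : exists2 n, (0 < n)%N & [~ x, y] ^+ n = 1.
    apply/finite_orderP => tinf; apply: (infinite_subgroup sgN _ tinf) => //.
    exact: KN.
  apply/ncxy/commgP/eqP/(frakX_commute_torsion hinf _ n0 tn).
  apply: (HCL _ Hh); rewrite /commg /conjg.
  by do ![apply: (subgM sgL) => // | apply: (subgV sgL)].
(* A noncyclic [H] contains its centralizer, hence [x]; but [H] commutes with [y]. *)
have [[_ _]] : H x by apply: (XG sgH Hnc) => h /HCL hL; apply/commute_sym/hL.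
by move/(_ y erefl).
Qed.

Lemma soluble_infinite_derived : infinite_set [set: G] -> soluble G ->
  exists n, infinite_set (@derived G n) /\ finite_set (@derived G n.+1).
Proof.
move=> Ginf [n Gn].
have : finite_set (@derived G n) by rewrite Gn; apply: finite_set1.
elim: n {Gn} => [//|n IHn] fin; have [/IHn//|inf] := pselect (finite_set (@derived G n)).
by exists n.
Qed.

(** Climb the derived series from its trivial term: if [M] meets the next term in an abelian group,
    it does so with the present one. Elements of [M] have powers in [<a>], which [M] centralizes,
    and a torsion element of [M] is trivial; both facts together kill the commutator [t]. *)
Lemma frakX_centralizer_abelian (a : G) : soluble G -> infinite_order a ->
  abelian_set (centralizer [set a]).
Proof.
move=> [n Gn] ainf; set M := centralizer _.
have sgM : is_subgroup M := centralizer_subgroup _.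
have Ma x : M x -> commute a x by move=> Mx; apply/commute_sym/Mx.
suff : abelian_set (M `&` @derived G 0) by move=> cM x y Mx My; apply: cM.
have : abelian_set (M `&` @derived G n).
  by rewrite Gn => _ _ [_ ->] [_ ->].
elim: n {Gn} => // n IHn cB; apply: IHn => x y [Mx Dx] [My Dy].
have MJ u v : M u -> M v -> M (u ^ v).
  by move=> Mu Mv; do ![apply: (subgM sgM) => // | apply: (subgV sgM)].
pose t := [~ x, y].
have Mt : M t by apply: (subgM sgM); [apply: (subgV sgM)|apply: MJ].
have Dt : derived n.+1 t by apply: derivedR.
(* [t ^ g] commutes with [t] by induction, and [t ^+ m] in [<a>] is fixed by [g]; so [t ^ g / t] is
   torsion and commutes with [a], hence is trivial. *)
have ct g : M g -> t ^ g = t.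
  move=> Mg; have Mtg := MJ _ _ Mt Mg.
  have ctg : commute (t ^ g) t by apply: cB; split=> //; apply: derived_normal.
  have [m [k [m0 tm]]] := frakX_commute_power ainf (Ma _ Mt).
  apply/divg1_eq/(frakX_commute_torsion ainf _ m0).
    by apply: Ma; apply: sgM.2.
  rewrite expgnFl // -conjXg tm zpowJ.
  by have /commgP := Ma _ Mg; rewrite -conjg_fix => /eqP->; rewrite mulgV.
apply/commgP/eqP; rewrite -/t.
have [m [k [m0 xm]]] := frakX_commute_power ainf (Ma _ Mx).
apply: (frakX_commute_torsion ainf (Ma _ Mt) m0).
(* Some power [x ^+ m] is fixed by [y], so [(x * t) ^+ m = x ^+ m] and [t ^+ m = 1]. *)
have xy : x ^ y = x * t by rewrite /t commgEl mulVKg.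
have cxt : commute x t by apply/commute_sym/commgP; rewrite -conjg_fix ct.
apply: (mulgI (x ^+ m)); rewrite -expgMn // -xy -conjXg xm mulg1 zpowJ.
by have /commgP := Ma _ My; rewrite -conjg_fix => /eqP->.
Qed.

(** The last infinite derived term is abelian. If noncyclic, it contains its centralizer; if it is
    [<a>], the centralizer of [a] takes its place. *)
Lemma frakX_self_centralizing : infinite_set [set: G] -> soluble G ->
  exists A, [/\ is_subgroup A, normal_set A, abelian_set A, infinite_set A
              & centralizer A `<=` A].
Proof.
move=> Ginf Gsol; have [n [Dinf Dfin]] := soluble_infinite_derived Ginf Gsol.
have sgD := @derived_subgroup G n; have nD := @derived_normal G n.
have cDD : abelian_set (@derived G n).
  apply: (frakX_finite_derived_abelian sgD Dinf _ Dfin); first exact: derived_subgroup.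
  by move=> x y; apply: derivedR.
have [/(is_cyclicP sgD)[a Da aD]|Dnc] := pselect (is_cyclic (@derived G n)); last first.
  by exists (derived n); split=> //; apply: XG.
have ainf := infinite_cyclic_generator Dinf aD.
have Caa : centralizer [set a] a by move=> _ ->; apply: commute_refl.
exists (centralizer [set a]); split.
- exact: centralizer_subgroup.
(* Normality: [a ^ g^-1] is a power of [a], so [x] commutes with it, and conjugating by [g] gives
   the claim. *)
- move=> x g Cx _ ->; have [k aE] := aD _ (nD _ g^-1 Da).
  rewrite -[a](conjgKV g) aE; apply/commgP; rewrite -conjRg; apply/eqP.
  by rewrite (eqP (introT commgP _)) ?conj1g //; apply/commuteZ/Cx.
- exact: frakX_centralizer_abelian.
- exact: infinite_subgroup (centralizer_subgroup _) Caa ainf.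
- by move=> x Cx _ ->; apply: Cx.
Qed.

End FrakX.

(** * Action on a Prufer subgroup *)

Section ChainAction.
Variables (G : groupType) (p : nat) (c : nat -> G).
Hypotheses (p_pr : prime p) (c_ch : is_chain p c).
Implicit Types (x y g h : G).
Let U := chain_union c.
Let sgU : is_subgroup U := chain_subgroup p_pr c_ch.
Let cUU : abelian_set U := chain_abelian c_ch.
Let Uc n : U (c n) := chain_in c n.

Definition normalizes g := forall x, U x -> U (x ^ g).

Lemma normalizesX g n : normalizes g -> normalizes (g ^+ n).
Proof.
move=> ng; elim: n => [|n IHn] x Ux; first by rewrite conjg1.
by rewrite expgSr conjgM; apply/ng/IHn.
Qed.

Lemma conjg_fixX g x n : x ^ g = x -> x ^ (g ^+ n) = x.
Proof.
move=> xg; elim: n => [|n IHn]; first by rewrite conjg1.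
by rewrite expgSr conjgM IHn.
Qed.

Lemma fixes_chain g : (forall n, c n ^ g = c n) -> forall x, U x -> x ^ g = x.
Proof. by move=> cg _ [n [k ->]]; rewrite conjXg cg. Qed.

(** The norm [1 + g + ... + g^(n-1)] applied to [x], in multiplicative notation. *)
Fixpoint cnorm g n x := if n is m.+1 then cnorm g m x * x ^ (g ^+ m) else 1.

Lemma cnorm_in g n x : normalizes g -> U x -> U (cnorm g n x).
Proof.
move=> ng Ux; elim: n => [|n IHn] /=; first exact: subg1.
by apply: (subgM sgU) => //; apply: (normalizesX n).
Qed.

Lemma cnormM g n x y : normalizes g -> U x -> U y ->
  cnorm g n (x * y) = cnorm g n x * cnorm g n y.
Proof.
move=> ng Ux Uy; elim: n => [|n IHn] /=; first by rewrite mulg1.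
rewrite IHn conjMg.
have := cUU (normalizesX n ng Ux) (cnorm_in n ng Uy).
move: (x ^ _) (y ^ _) (cnorm g n x) (cnorm g n y) => x' y' a b cxb.
by rewrite -!mulgA [x' * (b * y')]mulgA cxb -!mulgA.
Qed.

Lemma cnormJ g n x : cnorm g n x ^ g = x^-1 * cnorm g n x * x ^ (g ^+ n).
Proof.
elim: n => [|n IHn] /=; first by rewrite conj1g conjg1 mulg1 mulVg.
by rewrite conjMg IHn -conjgM -expgSr !mulgA.
Qed.

Lemma cnorm_fix g n x : x ^ g = x -> cnorm g n x = x ^+ n.
Proof. by move=> xg; elim: n => //= n ->; rewrite conjg_fixX // expgSr. Qed.

(* The norm maps U into the fixed points of g, and is onto as soon as it is nontrivial. *)
Lemma cnorm_fixes g n : normalizes g -> (forall x, U x -> x ^ (g ^+ n) = x) ->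
  (exists2 x, U x & cnorm g n x <> 1) -> forall x, U x -> x ^ g = x.
Proof.
move=> ng gn nt y Uy.
have NU x : U x -> U (cnorm g n x) by apply: cnorm_in.
have NM x z : U x -> U z -> cnorm g n (x * z) = cnorm g n x * cnorm g n z.
  exact: cnormM.
have [x Ux <-] := chain_endo_onto p_pr c_ch NU NM nt Uy.
by rewrite cnormJ gn // -mulgA (cUU _ Ux) ?mulKg //; apply: NU.
Qed.

Lemma socle_fixed g x : c 1%N ^ g = c 1%N -> U x -> x ^+ p = 1 -> x ^ g = x.
Proof.
move=> c1g Ux xp; have [k ->] := chain_layer (n := 1) p_pr c_ch Ux xp.
by rewrite conjXg c1g.
Qed.

(** Take for [z] the quotient of [c m.+1 ^ g] by [c m.+1]. Its [p]-th power is the same quotient for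
    [c m], which is trivial; so [g] fixes [z], and each further conjugation contributes one more
    factor [z]. *)
Lemma conjg_next_layer g m : normalizes g -> c 1%N ^ g = c 1%N -> c m ^ g = c m ->
  exists z, [/\ z ^+ p = 1, U z & forall i, c m.+1 ^ (g ^+ i) = c m.+1 * z ^+ i].
Proof.
move=> ng c1g cmg; pose z := (c m.+1)^-1 * c m.+1 ^ g.
have Ucg : U (c m.+1 ^ g) by apply: ng.
have Uz : U z by apply: (subgM sgU) => //; apply: (subgV sgU).
have zp : z ^+ p = 1.
  rewrite expgMn ?expVgn -?conjXg ?(chainS c_ch) ?cmg ?mulVg //.
  by apply: cUU => //; apply: (subgV sgU).
exists z; split=> //; elim=> [|i IHi]; first by rewrite conjg1 mulg1.
rewrite expgSr conjgM IHi conjMg conjXg (socle_fixed c1g Uz zp) expgS mulgA.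
by congr (_ * _); rewrite /z mulVKg.
Qed.

(** For [p = 2] the second layer is included because inversion fixes [c 1] and yet acts with order
    2. *)
Definition fixes_low g := c 1%N ^ g = c 1%N /\ (odd p \/ c 2%N ^ g = c 2%N).

(** By [cnorm_fixes] one element of nontrivial norm is enough. For [q <> p] take [c 1], of norm
    [c 1 ^+ q]; for [q = p] take [c 2], of norm [c 1]. *)
Lemma fixes_prime_order g q : prime q -> normalizes g -> fixes_low g ->
  (forall x, U x -> x ^ (g ^+ q) = x) -> forall x, U x -> x ^ g = x.
Proof.
move=> q_pr ng [c1g low] gq; apply: (cnorm_fixes ng gq).
have c11 : c 1%N <> 1 by case: c_ch.
have c2p : c 2%N ^+ p = c 1%N := chainS c_ch 1.
have [qp|qp] := eqVneq q p; last first.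
  exists (c 1%N) => //; rewrite cnorm_fix // => /(chain_order p_pr c_ch).
  by rewrite expn1 dvdn_prime2 // eq_sym (negbTE qp).
exists (c 2%N) => //; rewrite {q q_pr gq}qp; case: low => [p_odd|c2g]; last first.
  by rewrite cnorm_fix // c2p.
have [z [zp Uz zX]] := conjg_next_layer ng c1g c1g.
(* Since [c 2 ^ (g ^+ i) = c 2 * z ^+ i], the exponents of [z] add up to [0 + 1 + ... + (n - 1)].
   For [n = p] odd this sum is a multiple of [p], and the factor vanishes. *)
have NE n : cnorm g n (c 2%N) = c 2%N ^+ n * z ^+ 'C(n, 2).
  elim: n => [|n IHn] /=; first by rewrite mulg1.
  rewrite IHn zX binS bin1 expgSr expgnDr -!mulgA; congr (_ * _).
  by rewrite !mulgA (cUU (subgX sgU _ Uz) (Uc 2)).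
have p2 : (2 < p)%N by rewrite odd_prime_gt2.
have /dvdnP[j jE] : (p %| 'C(p, 2))%N by rewrite prime_dvd_bin.
by rewrite NE jE mulnC expgnA zp expg1n mulg1 c2p.
Qed.

(* Units of the p-adic integers that are 1 mod p (mod 4 if p = 2) have infinite order. *)
Lemma fixes_finite_order g n : (0 < n)%N -> normalizes g -> fixes_low g ->
  (forall x, U x -> x ^ (g ^+ n) = x) -> forall x, U x -> x ^ g = x.
Proof.
elim/ltn_ind: n g => n IHn g n0 ng low gn.
have [n1|n1] := leqP n 1; first by have -> : g = g ^+ n by have -> : n = 1%N by lia.
pose q := pdiv n; have q_pr : prime q := pdiv_prime n1.
have nE : n = (q * (n %/ q))%N by rewrite mulnC divnK ?pdiv_dvd.
(* It remains to see that [g ^+ q] acts trivially; this is the induction hypothesis, as its power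
   [n %/ q] is [g ^+ n]. *)
apply: (fixes_prime_order q_pr) => //; apply: (IHn (n %/ q)%N).
- by rewrite ltn_Pdiv // prime_gt1.
- by rewrite divn_gt0 ?prime_gt0 // dvdn_leq // pdiv_dvd.
- exact: normalizesX.
- by case: low => c1g low; split; [|case: low; [left|right]]; rewrite ?conjg_fixX.
- by rewrite -expgnA -nE.
Qed.

End ChainAction.

(** * Elements fixing the socle of a self-centralizing Prufer subgroup *)

Section FrakXPrufer.
Variables (G : groupType) (p : nat) (c : nat -> G).
Hypotheses (XG : frakX_group G) (p_pr : prime p) (c_ch : is_chain p c).
Let U := chain_union c.
Hypotheses (nU : normal_set U) (CU : centralizer U `<=` U).

Lemma fixes_sub g : (forall x, U x -> x ^ g = x) -> U g.
Proof.
move=> gU; apply: CU => x Ux; apply/commute_sym/commgP.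
by rewrite -conjg_fix gU.
Qed.

Lemma frakX_prufer_fixed_socle g : c 1%N ^ g = c 1%N -> ~ U g ->
  p = 2 /\ forall x, U x -> x ^ g = x^-1.
Proof.
move=> c1g Ug; have ng : normalizes c g by move=> x Ux; apply: nU.
have Uc n : U (c n) := chain_in c n.
have ex : exists n, c n ^ g != c n.
  apply: contrapT => /forallNP cg; apply/Ug/fixes_sub/fixes_chain => n.
  by apply/eqP; have /negP := cg n; rewrite negbK.
have [k /eqP ckg kmin] := ex_minnP ex.
have c0 := chain0 c_ch; have c11 : c 1%N <> 1 by case: c_ch.
(* [c 0] and [c 1] are fixed, so the first generator moved by [g] is [c m.+2]. *)
case: k ckg kmin => [|[|m]] ckg kmin; first by rewrite c0 conj1g in ckg.
  by rewrite c1g in ckg.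
have cmg : c m.+1 ^ g = c m.+1.
  by apply/eqP; apply: contraT => /kmin; rewrite ltnn.
pose h := g ^+ p.
have next n : c n ^ g = c n -> c n.+1 ^ h = c n.+1.
  move=> cng; have [z [zp Uz ->]] := conjg_next_layer p_pr c_ch ng c1g cng.
  by rewrite zp mulg1.
have cgm : commute (c m.+1) g by apply/commgP; rewrite -conjg_fix cmg.
have chm : commute h (c m.+1) by apply/commute_sym/commuteX.
have chm2 : commute h (c m.+2).
  by apply/commute_sym/commgP; rewrite -conjg_fix next.
have sgH := prod2_subgroup chm.
(* If noncyclic, [<h, c m.+1>] contains [c m.+2], which centralizes it; but all its elements commute
   with [g], while [c m.+2] does not. *)
have [/(is_cyclicP sgH)[z Hz zH]|Hnc] := pselect (is_cyclic (prod2 h (c m.+1))); last first.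
  have : prod2 h (c m.+1) (c m.+2).
    apply: (XG sgH Hnc) => _ [k [l ->]]; apply: commuteM.
      exact/commuteZ/commute_sym.
    by apply: commuteZ; apply: (chain_abelian c_ch (Uc _) (Uc _)).
  case=> k [l cE]; case: ckg; apply/conjg_fixP/commgP; rewrite cE.
  apply/commute_sym/commuteM; apply: commuteZ; last exact/commute_sym.
  exact/commuteX/commute_refl.
(* A cyclic group containing the nontrivial torsion element [c m.+1] is finite. *)
have [n n0 hn] : exists2 n, (0 < n)%N & h ^+ n = 1.
  have [i hE] := zH _ (prod2l h (c m.+1) 1%R).
  have [j cE] := zH _ (prod2r h (c m.+1) 1%R).
  have [k k0 ck] := chain_torsion p_pr c_ch (Uc m.+1).
  apply/finite_orderP => hinf.
  have zinf : infinite_order z by apply: (infinite_orderZ (k := i)); rewrite -hE.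
  have /(zpow_eq1 zinf)/eqP : zpow z (j * k%:Z)%R = 1 by rewrite zpowM -cE.
  rewrite mulf_eq0 => /orP[/eqP j0|]; last by lia.
  apply: c11; have -> : c 1%N = c m.+1 ^+ (p ^ m) by rewrite -(chainX c_ch 1 m).
  by rewrite -[c m.+1]zpow1 cE j0 zpow0 expg1n.
have hU x : U x -> x ^ h = x.
  have nh : normalizes c h by apply: normalizesX.
  (* [h] satisfies [fixes_low] even for [p = 2]: as [g] fixes [c 1], [next] shows that [h] fixes
     [c 2]. *)
  apply: (fixes_finite_order p_pr c_ch n0 nh).
    by split; [apply: conjg_fixX|right; apply: next].
  by move=> y _; rewrite hn conjg1.
have p2 : p = 2.
  (* For [p] odd, [g] itself satisfies [fixes_low], and [h = g ^+ p] acts trivially. *)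
  have [//|p_odd] := even_prime p_pr; case: Ug; apply: fixes_sub.
  by apply: (fixes_prime_order p_pr c_ch p_pr ng) => //; split=> //; left.
(* [x * x ^ g] is the norm of [x] with two factors; were it nontrivial, [g] would fix all of [U]. *)
split=> // x Ux; apply/esym/mulg1_eq; apply: contrapT => nt; apply/Ug/fixes_sub.
rewrite /h p2 in hU.
apply: (cnorm_fixes p_pr c_ch ng hU); exists x => //.
by rewrite /= mul1g conjg1.
Qed.

End FrakXPrufer.

(** * Isomorphisms of Prufer groups *)

Section PruferIso.
Variable p : nat.
Hypothesis p_pr : prime p.

Lemma chain_expg_eq (G : groupType) (c : nat -> G) n k l : is_chain p c ->
  c n ^+ k = c n ^+ l <-> (k = l %[mod p ^ n])%N.
Proof.
move=> c_ch; wlog kl : k l / (k <= l)%N.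
  move=> wl; have [/wl//|/ltnW/wl lk] := leqP k l.
  by split=> /esym/lk/esym.
have -> : (k = l %[mod p ^ n])%N <-> (p ^ n %| l - k)%N.
  by rewrite -eqn_mod_dvd //; split=> [->//|/eqP].
rewrite -(chain_order p_pr c_ch) expgnFr //.
by split=> [->|/divg1_eq//]; rewrite mulgV.
Qed.

(** [c n ^+ k |-> d n ^+ k] is well defined and injective, because equality of powers is the same
    congruence modulo [p ^ n] in both chains. *)
Lemma is_prufer_isog (G K : groupType) (A : set G) (B : set K) :
  is_prufer p A -> is_prufer p B -> isog A B.
Proof.
move=> [_ [c c_ch ->]] [_ [d d_ch ->]].
have /choice[f fP] : forall x, exists y, chain_union c x ->
    exists n k, x = c n ^+ k /\ y = d n ^+ k.
  move=> x; have [[n [k xE]]|nx] := pselect (chain_union c x); last by exists 1.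
  by exists (d n ^+ k) => _; exists n, k.
have fE n k : f (c n ^+ k) = d n ^+ k.
  have [|m [l [cE ->]]] := fP (c n ^+ k); first by exists n, k.
  (* Two representations, at levels [n] and [m], are compared at the common level [n + m]. *)
  rewrite -(chainX d_ch n m) -(chainX d_ch m n) [(m + n)%N]addnC -!expgnA.
  apply/(chain_expg_eq _ _ _ d_ch)/(chain_expg_eq _ _ _ c_ch).
  by rewrite !expgnA addnC chainX // addnC chainX.
exists f; split=> [x y Ux Uy|].
  have [n [k [l [-> ->]]]] := chain_common c_ch Ux Uy.
  by rewrite -expgnDr !fE expgnDr.
split=> [_ [n [k ->]]|x y /set_mem Ux /set_mem Uy|_ [n [k ->]]].
- by rewrite fE; exists n, k.
- have [n [k [l [-> ->]]]] := chain_common c_ch Ux Uy.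
  by rewrite !fE => /(chain_expg_eq _ _ _ d_ch) kl; apply/(chain_expg_eq _ _ _ c_ch).
- by exists (c n ^+ k); [exists n, k|apply: fE].
Qed.

Lemma isog_is_prufer (G K : groupType) (A : set G) (B : set K) :
  is_subgroup A -> isog A B -> is_prufer p B -> is_prufer p A.
Proof.
move=> sgA [f [fM [fAB finj fsurj]]] [_ [d d_ch BE]].
have f1 : f 1 = 1 by apply: (mulgI (f 1)); rewrite -fM ?mulg1 //; apply: subg1.
have fX x n : A x -> f (x ^+ n) = f x ^+ n.
  move=> Ax; elim: n => [|n IHn]; first by rewrite !expg0.
  by rewrite !expgS fM ?IHn //; apply: (subgX sgA).
have fI x y : A x -> A y -> f x = f y -> x = y by move=> Ax Ay; apply: finj; rewrite inE.
have /choice[c cP] : forall n, exists x, A x /\ f x = d n.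
  move=> n; have /fsurj[x Ax fx] : B (d n) by rewrite BE; apply: chain_in.
  by exists x.
have cA n : A (c n) := (cP n).1; have cE n : f (c n) = d n := (cP n).2.
split=> //; exists c; first split.
- by apply: fI; rewrite ?cE ?f1 ?(chain0 d_ch) //; apply: subg1.
- by move=> c1; case: d_ch => _ d1 _; apply: d1; rewrite -cE c1.
- by move=> n; apply: fI; rewrite ?fX ?cE ?(chainS d_ch) //; apply: (subgX sgA).
apply/seteqP; split=> [x Ax|_ [n [k ->]]]; last exact: (subgX sgA).
have : B (f x) by apply: fAB.
rewrite BE => -[n [k fx]]; exists n, k.
by apply: fI; rewrite ?fX ?cE //; apply: (subgX sgA).
Qed.

Lemma prufer_valX (z : prufer p) n : prufer_val (z ^+ n) = (prufer_val z ^+ n)%R.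
Proof. by elim: n => [//|n IHn]; rewrite expgS exprS -IHn. Qed.

(** Iterated [p]-th roots of a primitive [p]-th root of unity form a chain; its [n]-th term is a
    primitive root of order [p ^ n], so its powers exhaust the roots of that order. *)
Lemma prufer_is_prufer : is_prufer p [set: prufer p].
Proof.
split=> //; have p0 := prime_gt0 p_pr.
have [w wP] := C_prim_root_exists p0.
have rootU (z : prufer p) : ppower_unity p (p.-root (z : algC))%R.
  have /andP[z0 /asboolP[n zn]] := pruferP z.
  rewrite /ppower_unity rootC_eq0 // z0; apply/asboolP.
  by exists n.+1; rewrite expnS exprM rootCK.
have wU : ppower_unity p w.
  rewrite /ppower_unity; apply/andP; split.
    apply/eqP => w0; have := prim_expr_order wP.
    by rewrite w0 expr0n gtn_eqF // => /eqP; rewrite eq_sym oner_eq0.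
  by apply/asboolP; exists 1%N; rewrite expn1 (prim_expr_order wP).
pose r z := Prufer (rootU z).
pose d n := if n is m.+1 then iter m r (Prufer wU) else 1.
have d_ch : is_chain p d.
  split=> // [|[|n]].
  - move=> /(congr1 (@prufer_val p)) /= w1; have := prim_order_dvd wP 1.
    by rewrite expr1 w1 eqxx dvdn1 => /eqP p1; move: p_pr; rewrite p1.
  - by apply: val_inj; rewrite /= prufer_valX /= (prim_expr_order wP).
  - by apply: val_inj; rewrite /= prufer_valX /= rootCK.
exists d => //; apply/seteqP; split=> // z _.
have /andP[_ /asboolP[n zn]] := pruferP z.
have dn : ((p ^ n)%N.-primitive_root (d n : algC))%R.
  apply/andP; split; first by rewrite expn_gt0 p0.
  apply/forallP => i; rewrite unity_rootE -prufer_valX.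
  have -> (u : prufer p) : (prufer_val u == 1%R) = (u == 1) by [].
  apply/eqP; apply/eqP/eqP => [/(chain_order p_pr d_ch) /dvdn_leq ile|->].
    by apply/eqP; rewrite eqn_leq ile // ltn_ord.
  exact/(chain_order p_pr d_ch).
have [k zE] := prim_rootP dn zn; exists n, k; apply: val_inj.
by rewrite /= prufer_valX.
Qed.
End PruferIso.

(** * Subgroups of the holomorph *)

Section HolomorphIso.
Variables (G B : groupType).

Lemma range_subgroup (K : groupType) (theta : G -> K) :
  {morph theta : g h / g * h} -> is_subgroup (range theta).
Proof.
move=> tM; have t1 : theta 1 = 1 by apply: (mulgI (theta 1)); rewrite -tM !mulg1.
split=> [|_ _ [g _ <-] [h _ <-]]; first by exists 1.
exists (g / h) => //; rewrite tM; congr (_ * _); apply/esym/mulg1_eq.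
by rewrite -tM mulgV.
Qed.

(** Recognition of split extensions: [A] being abelian and self-centralizing, the conjugation action
    [theta] has kernel [A], so the [A]-component of [g] together with [theta g] determines [g]. *)
Lemma isog_sdprod_aut (A Q : set G) (f : G -> B) :
  is_subgroup A -> abelian_set A -> normal_set A -> centralizer A `<=` A ->
  is_subgroup Q -> (forall g, exists a q, [/\ A a, Q q & g = a * q]) ->
  A `&` Q `<=` [set 1] ->
  (forall x y, A x -> A y -> f (x * y) = f x * f y) -> set_bij A setT f ->
  exists theta : G -> aut B,
    [/\ {morph theta : g h / g * h},
        forall g a, A a -> theta g (f a) = f (a ^ g^-1)
      & isog [set: G] (sdprod_aut (range theta))].
Proof.
move=> sgA cAA nA CA sgQ AQ AIQ fM [_ finj fsurj].
have fI x y : A x -> A y -> f x = f y -> x = y by move=> Ax Ay; apply: finj; rewrite inE.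
have /choice[e eP] : forall b, exists a, A a /\ f a = b.
  by move=> b; have [a Aa ab] := fsurj b I; exists a.
have eA b : A (e b) := (eP b).1; have eK b : f (e b) = b := (eP b).2.
have fK a : A a -> e (f a) = a by move=> Aa; apply: fI; rewrite ?eK.
(* The inverse turns the right action [x ^ g] into the left action that composition of automorphisms
   requires. *)
pose act g b := f (e b ^ g^-1).
have actM g : {morph act g : x y / x * y}.
  move=> x y; rewrite /act -fM; try exact: nA.
  rewrite -conjMg; congr (f (_ ^ _)); apply: fI; rewrite ?fM ?eK //.
  by apply: subgM.
have actE g a : A a -> act g (f a) = f (a ^ g^-1) by move=> Aa; rewrite /act fK.
have actact g h b : act g (act h b) = act (g * h) b.
  by rewrite actE; [rewrite -conjgM -invgM|apply: nA].
have act1 b : act 1 b = b by rewrite /act invg1 conjg1 eK.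
have actK g : cancel (act g) (act g^-1) by move=> b; rewrite actact mulVg act1.
have actVK g : cancel (act g^-1) (act g) by move=> b; rewrite actact mulgV act1.
pose theta g := Aut (actM g) (actK g) (actVK g).
have thM : {morph theta : g h / g * h}.
  by move=> g h; apply: aut_ext => b /=; rewrite -actact.
have thA g : theta g = 1 -> A g.
  move=> g1; apply: CA => a Aa; apply/commute_sym/commgP; rewrite -conjg_fix.
  have : act g (f a) = f a by rewrite -[act g _]/(theta g (f a)) g1.
  rewrite actE // => /fI -/(_ (nA _ _ Aa) Aa) ag.
  by rewrite -{1}ag conjgKV.
have th1 a : A a -> theta a = 1.
  move=> Aa; apply: aut_ext => b /=; rewrite /act -[RHS]eK; congr f.
  apply/eqP; rewrite conjg_fix; apply/commgP/cAA => //; exact: subgV.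
have /choice[pi piP] : forall g, exists a, A a /\ exists2 q, Q q & g = a * q.
  by move=> g; have [a [q [Aa Qq gE]]] := AQ g; exists a; split=> //; exists q.
have piA g : A (pi g) := (piP g).1.
have piE a q : A a -> Q q -> pi (a * q) = a.
  move=> Aa Qq; have [r Qr E] := (piP (a * q)).2.
  have aqE : (pi (a * q))^-1 * a = r / q.
    by apply: (mulIg q); rewrite mulgVK -mulgA {2}E mulKg.
  have /mulg1_eq : (pi (a * q))^-1 * a = 1.
    apply: AIQ; split; last by rewrite aqE; apply: sgQ.2.
    by apply: (subgM sgA) => //; apply: (subgV sgA).
  by rewrite invgK.
exists theta; split=> //.
exists (fun g => Hol (f (pi g)) (theta g)); split=> [g h _ _|].
  congr Hol; last exact: thM.
  have [q Qq gE] := (piP g).2; have [r Qr hE] := (piP h).2.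
  have Ahg x : A (pi h ^ x) by apply: nA.
  rewrite /= /act fK // -fM //; congr f.
  (* [g = pi g * q] and [q] act alike on the abelian group [A]. *)
  have <- : pi h ^ q^-1 = pi h ^ g^-1.
    rewrite gE invgM conjgM; apply/esym/eqP; rewrite conjg_fix.
    by apply/commgP/cAA => //; apply: (subgV sgA).
  have {1}-> : g * h = pi g * pi h ^ q^-1 * (q * r).
    by rewrite {1}gE {1}hE /conjg invgK !mulgA mulgVK.
  by apply: piE; [apply: (subgM sgA)|apply: (subgM sgQ)].
split=> [g _|g h _ _ gh|[b t] [g _ /= tE]].
- by exists g.
- have pgh : pi g = pi h by apply: fI => //; have := congr1 (@hol_base B) gh.
  have tgh : theta g = theta h := congr1 (@hol_aut B) gh.
  have : A (g / h).
    apply: thA; rewrite thM tgh -thM mulgV; apply: th1; exact: subg1.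
  have [q Qq gE] := (piP g).2; have [r Qr hE] := (piP h).2.
  rewrite gE hE -pgh invgM !mulgA => Aqr.
  have /AIQ/divg1_eq -> // : (A `&` Q) (q / r).
  split; last exact: sgQ.2.
  have := nA _ (pi g) Aqr.
  by rewrite conjgE !mulgA mulVg mul1g mulgVK.
- have [q Qq gE] := (piP g).2.
  exists (e b * q) => //; congr Hol; first by rewrite piE.
  by rewrite thM (th1 (e b)) // mul1g -tE [in RHS]gE thM (th1 (pi g)) // mul1g.
Qed.

(* Only for commutative B does conjugation by Hol b t act on B through t alone. *)
Lemma sdprod_aut_action (D : set (aut B)) :
  (forall x y : B, commute x y) -> is_subgroup D -> isog [set: G] (sdprod_aut D) ->
  exists (e : B -> G) (theta : G -> aut B),
    [/\ injective e /\ {morph e : x y / x * y}, {morph theta : g h / g * h},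
        (forall g, D (theta g)), (forall g b, e b ^ g^-1 = e (theta g b))
      & forall g, theta g = 1 <-> range e g].
Proof.
move=> cB sgD [F [FM [FD Finj Fsurj]]].
have FI : injective F by move=> g h; apply: Finj; rewrite inE.
have {}FM : {morph F : g h / g * h} by move=> g h; apply: FM.
have /choice[e eP] : forall b, exists g, F g = Hol b 1.
  by move=> b; have [|g _ gE] := Fsurj (Hol b 1); [apply: subg1|exists g].
exists e, (fun g => hol_aut (F g)); split=> [|g h|g|g b|g] /=; first split=> x y.
- by move/(congr1 F); rewrite !eP => -[].
- by apply: FI; rewrite FM !eP; congr Hol; rewrite mulg1.
- by rewrite FM.
- by apply: FD.
- have E : g * e b = e (hol_aut (F g) b) * g.
    apply: FI; rewrite !FM !eP; congr Hol; last by rewrite mulg1 mul1g.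
    exact: cB.
  by rewrite conjgE invgK mulgA E mulgK.
split=> [g1|[b _ <-]]; last by rewrite eP.
exists (hol_base (F g)) => //; apply: FI; rewrite eP -g1; by case: (F g).
Qed.

End HolomorphIso.

(** * Groups with a large abelian subgroup *)

Section FrakXConverse.
Variable G : groupType.
Implicit Types (A H : set G) (g h x : G).

Lemma conjg_inverted A g a : (forall x, A x -> x ^ g = x^-1) -> A a -> a ^ g^-1 = a^-1.
Proof. by move=> gA Aa; apply: (conjg_inj g); rewrite conjgKV conjVg gA // invgK.
Qed.

Lemma inverting_div A g h : centralizer A `<=` A ->
  (forall x, A x -> x ^ g = x^-1) -> (forall x, A x -> x ^ h = x^-1) -> A (g / h).
Proof.
move=> CA gA hA; apply: CA => a Aa; apply/commute_sym/commgP.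
by rewrite -conjg_fix conjgM gA // conjVg (conjg_inverted hA) // invgK.
Qed.

(** Common criterion for both dihedral-like families. A noncyclic [H] not inside [A] contains some
    [h] outside [A] and some [b <> 1] in [A]. If [x] centralizes [H], then [x] or [x / h] lies in
    [A] and is both fixed and inverted by [h], so it has square 1 and is a power of [b]. *)
Lemma frakX_inverted A : is_subgroup A ->
  (forall g, ~ A g -> forall a, A a -> a ^ g = a^-1) ->
  (forall H, is_subgroup H -> H `<=` A -> ~ is_cyclic H -> H = A) ->
  (forall a b, A a -> A b -> a ^+ 2 = 1 -> b <> 1 -> exists k, a = zpow b k) ->
  (exists2 a, A a & a ^+ 2 <> 1) -> frakX_group G.
Proof.
move=> sgA invA minA socA [a0 Aa0 a02] H sgH Hnc.
have sq1 (a : G) : a = a^-1 -> a ^+ 2 = 1.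
  by move=> aV; rewrite expg2 {2}aV mulgV.
have CA : centralizer A `<=` A.
  move=> g Cg; apply: contrapT => Ag; apply/a02/sq1.
  rewrite -(invA g Ag a0 Aa0); apply/esym/eqP; rewrite conjg_fix.
  exact/commgP/commute_sym/Cg.
have [HA|] := pselect (H `<=` A); first by rewrite (minA H sgH HA Hnc).
move=> /existsNP[h /not_implyP[Hh Ah]].
(* Quotients of elements outside [A] lie in [A], so if [H] met [A] trivially it would consist of [1]
   and [h]. *)
have [b [Hb Ab b1]] : exists b, [/\ H b, A b & b <> 1].
  apply: contrapT => nob; apply/Hnc/(is_cyclicP sgH); exists h => // g Hg.
  have HA1 x : H x -> A x -> x = 1.
    by move=> Hx Ax; apply: contrapT => x1; apply: nob; exists x.
  have [Ag|Ag] := pselect (A g); first by exists 0%R; rewrite (HA1 g).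
  exists 1%R; apply/divg1_eq/HA1; first exact: sgH.2.
  by apply: inverting_div => //; apply: invA.
have key x : A x -> commute x h -> H x.
  move=> Ax cxh; have [|k ->] := socA x b Ax Ab _ b1; last exact: subgZ.
  by apply: sq1; rewrite -(invA h Ah x Ax); apply/esym/eqP; rewrite conjg_fix; apply/commgP.
move=> x Cx; have cxh : commute x h by apply: Cx.
have [Ax|Ax] := pselect (A x); first exact: key.
rewrite -[x](mulgVK h); apply: (subgM sgH) => //; apply: key.
  by apply: inverting_div => //; apply: invA.
by rewrite /commute mulgVK mulgA -cxh mulgK.
Qed.

End FrakXConverse.

(** * Prufer groups extended by elements moving the socle *)

Section FrobeniusConverse.
Variables (G : groupType) (p : nat) (c : nat -> G).
Hypotheses (p_pr : prime p) (c_ch : is_chain p c).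
Let U := chain_union c.
Hypotheses (nU : normal_set U) (fpf : forall g, ~ U g -> c 1%N ^ g <> c 1%N).

(* H acts faithfully on the subgroup of order p, so it embeds in the unit group of F_p. *)
Lemma complement_cyclic H : is_subgroup H -> H `&` U `<=` [set 1] -> is_cyclic H.
Proof.
move=> sgH HU.
have /choice[k kE] : forall g, exists k, c 1%N ^ g = c 1%N ^+ k.
  move=> g; apply: (chain_layer (n := 1) p_pr c_ch); first exact/nU/chain_in.
  by rewrite expn1 -conjXg (chainS c_ch) (chain0 c_ch) conj1g.
have eqk a b : c 1%N ^+ a = c 1%N ^+ b <-> (a%:R = b%:R :> 'F_p)%R.
  rewrite (chain_expg_eq p_pr _ _ _ c_ch) expn1.
  split=> [ab|/(congr1 (@nat_of_ord _))]; last by rewrite !val_Fp_nat.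
  by apply: val_inj; rewrite /= !val_Fp_nat.
have kM (g h : G) : ((k (g * h)%g)%:R = (k g)%:R * (k h)%:R :> 'F_p)%R.
  rewrite -natrM; apply/eqk; rewrite -kE conjgM kE conjXg kE -expgnA mulnC //.
have kI g h : H g -> H h -> ((k g)%:R = (k h)%:R :> 'F_p)%R -> g = h.
  move=> Hg Hh /eqk; rewrite -!kE => gh; apply: divg1_eq; apply: HU.
  split; first exact: sgH.2.
  by apply: contrapT => /fpf; apply; rewrite conjgM gh -conjgM mulgV conjg1.
have k1 : ((k 1%g)%:R = 1 :> 'F_p)%R.
  by rewrite -[1%R]/((1%N)%:R)%R; apply/eqk; rewrite -kE conjg1.
have kU g : ((k g)%:R : 'F_p)%R \is a GRing.unit.
  rewrite unitfE; apply/eqP => g0; have := kM g g^-1.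
  by rewrite g0 mulgV k1 mul0r => /eqP; rewrite oner_eq0.
pose phi g : {unit 'F_p} := FinRing.unit 'F_p (kU g).
have phiM g h : phi (g * h) = phi g * phi h by apply: val_inj; rewrite /= kM.
pose I : {set {unit 'F_p}} := finset (fun u => `[< exists2 h, H h & u = phi h >]).
have inI h : H h -> phi h \in I by move=> Hh; rewrite inE; apply/asboolP; exists h.
have gI : fingroup.group_set I.
  apply/fingroup.group_setP; split.
    rewrite inE; apply/asboolP; exists 1; first exact: subg1.
    by apply: val_inj; rewrite /= k1.
  move=> u v; rewrite !inE => -[g Hg ->] [h Hh ->].
  by exists (g * h); [apply: subgM|rewrite phiM].
have /cyclicP[u IE] : cyclic (Group gI) by apply: field_unit_group_cyclic.
have : u \in I by rewrite [I]IE cycle_id.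
rewrite inE => /asboolP[h Hh uE]; apply/(is_cyclicP sgH); exists h => // g Hg.
have : phi g \in <[u]> by rewrite -IE inI.
move=> /cycleP[i giE]; exists i; apply: kI => //; first exact: subgX.
have phiX j : phi (h ^+ j) = u ^+ j.
  elim: j => [|j IHj]; first by apply: val_inj; rewrite /= k1.
  by rewrite !expgS phiM IHj -uE.
by have /(congr1 val) := etrans giE (esym (phiX i)).
Qed.

(** A noncyclic [H] inside [U] is [U]. Otherwise [H] meets [U] nontrivially, by [complement_cyclic],
    so [c 1] is in [H] and [C(H)] lies in [U]; a nontrivial [x] there has [c 1] as a power, which an
    [h] of [H] outside [U] would then fix. *)
Lemma frakX_frobenius : frakX_group G.
Proof.
move=> H sgH Hnc; have Uc n : U (c n) := chain_in c n.
have CU x : commute x (c 1%N) -> U x.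
  move=> cx; apply: contrapT => /fpf; apply; apply/eqP; rewrite conjg_fix.
  exact/commgP/commute_sym.
have [HU|] := pselect (H `<=` U).
  rewrite (chain_min_noncyclic p_pr c_ch sgH HU Hnc) => x Cx.
  exact/CU/Cx/Uc.
move=> /existsNP[h /not_implyP[Hh Uh]].
have [b [Hb Ub b1]] : exists b, [/\ H b, U b & b <> 1].
  apply: contrapT => nob; apply/Hnc/complement_cyclic => // x [Hx Ux].
  by apply: contrapT => x1; apply: nob; exists x.
have [j c1E] := chain_bottom p_pr c_ch Ub b1.
have Hc1 : H (c 1%N) by rewrite c1E; apply: subgX.
move=> x Cx; have Ux : U x by apply/CU/Cx.
have [->|x1] := pselect (x = 1); first exact: subg1.
have [i c1x] := chain_bottom p_pr c_ch Ux x1; case: (fpf Uh).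
apply/eqP; rewrite conjg_fix c1x; apply/commgP.
exact/commute_sym/commuteX/commute_sym/Cx.
Qed.

End FrobeniusConverse.

(** * The classification *)

Lemma generated_Zgroup_inv t : generated [set Zgroup_inv] t -> t <> 1 -> t = Zgroup_inv.
Proof.
have inv2 : Zgroup_inv ^+ 2 = 1 by apply: aut_ext => b; apply: invgK.
by rewrite generated1E => -[k _ <-]; have [[|[|]] // _ ->] := zpow_mod k (isT : (0 < 2)%N) inv2.
Qed.

Lemma generated_card (G : groupType) (y : G) n : (0 < n)%N -> y ^+ n = 1 ->
  (forall j, (0 < j < n)%N -> y ^+ j <> 1) -> (generated [set y] #= `I_n)%card.
Proof.
move=> n0 yn ymin.
have yI i j : (i <= j)%N -> (j < n)%N -> y ^+ i = y ^+ j -> i = j.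
  move=> ij jn E; have [//|ne] := eqVneq i j; case: (ymin (j - i)%N); first by lia.
  by rewrite expgnFr // E mulgV.
have -> : generated [set y] = (fun k : nat => y ^+ k) @` `I_n.
  rewrite generated1E; apply/seteqP; split=> [_ [k _ <-]|_ [k _ <-]]; last by exists k.
  by have [j jn ->] := zpow_mod k n0 yn; exists j.
apply: inj_card_eq => i j /set_mem /= i_n /set_mem /= j_n E.
by have [ij|/ltnW ji] := leqP i j; [apply: yI|apply/esym/yI].
Qed.

(** * From a self-centralizing abelian subgroup to the listed families *)

Section FrakXForward.
Variables (G : groupType) (A : set G).
Hypotheses (XG : frakX_group G) (sgA : is_subgroup A) (nA : normal_set A).
Hypotheses (cAA : abelian_set A) (A_inf : infinite_set A) (CA : centralizer A `<=` A).

Lemma self_centralizing_fix g : (forall a, A a -> a ^ g = a) -> A g.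
Proof.
move=> gA; apply: CA => a Aa; apply/commute_sym/commgP.
by rewrite -conjg_fix gA.
Qed.

Lemma conjg_abelian a g : A a -> A g -> a ^ g = a.
Proof. by move=> Aa Ag; apply/eqP; rewrite conjg_fix; apply/commgP/cAA. Qed.

(** Conjugation sends [a] to [a ^ k] with [k] invertible in the integers, and [k = 1] only inside
    [A]. So elements outside [A] invert [A], and [1], [y] form a complement. *)
Lemma self_centralizing_cyclic : is_cyclic A -> A <> setT ->
  isog [set: G] infinite_dihedral.
Proof.
move=> /(is_cyclicP sgA)[a Aa aA] AT.
have ainf := infinite_cyclic_generator A_inf aA.
have invA g : ~ A g -> forall x, A x -> x ^ g = x^-1.
  move=> Ag; have [k agE] := aA _ (nA g Aa); have [l agVE] := aA _ (nA g^-1 Aa).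
  have /(zpow_inj ainf) kl : zpow a (k * l)%R = zpow a 1%R.
    by rewrite zpowM -agE -zpowJ -agVE conjgKV.
  have k1 : k <> 1%R.
    move=> k1; apply/Ag/self_centralizing_fix => x /aA[i ->].
    by rewrite zpowJ agE k1.
  have {}kl : k = (-1)%R.
    have /eqP : (`|k| * `|l|)%N = 1%N by rewrite -abszM kl.
    by rewrite muln_eq1 => /andP[/eqP k1' _]; lia.
  by move=> x /aA[i ->]; rewrite zpowJ agE kl zpowN zpow1 -[a^-1]/(zpow a (-1)%R)
    -zpowM mulN1r zpowN.
have [y Ay] : exists y, ~ A y by apply/setTPn/eqP.
have AV (g : G) : ~ A g -> ~ A g^-1.
  by move=> Ag AgV; apply: Ag; rewrite -[g]invgK; apply: subgV.
(* [y ^+ 2] lies in the torsion-free [A] and is both fixed and inverted by [y]. *)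
have y2 : y ^+ 2 = 1.
  have Ay2 : A (y ^+ 2).
    by rewrite expg2 -{2}[y]invgK; apply: inverting_div => //; apply: invA; [|apply: AV].
  have : (y ^+ 2) ^ y = y ^+ 2 by rewrite conjXg /conjg mulKg.
  rewrite invA // => E; have [i yE] := aA _ Ay2.
  move: E; rewrite yE -zpowN => /(zpow_inj ainf) iE.
  by have -> : i = 0%R by lia.
have /choice[f fE] : forall x, exists k : Zgroup, A x -> x = zpow a k.
  move=> x; have [/aA[k xE]|nAx] := pselect (A x); last by exists 1.
  by exists k.
have fK k : f (zpow a k) = k.
  by apply/esym/(zpow_inj ainf)/fE; apply: subgZ.
pose Q := [set 1; y].
have yV : y^-1 = y by apply: mulg1_eq.
have sgQ : is_subgroup Q.
  split=> [|u v]; first by left.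
  by case=> -> [] ->; rewrite ?invg1 ?mulg1 ?yV -?expg2 ?y2 ?mul1g; [left|right|right|left].
have AQ g : exists x q, [/\ A x, Q q & g = x * q].
  have [Ag|Ag] := pselect (A g).
    by exists g, 1; split; [|left|rewrite mulg1].
  exists (g / y), y; split; [|by right|by rewrite mulgVK].
  by apply: inverting_div => //; apply: invA.
have AIQ : A `&` Q `<=` [set 1] by move=> x [Ax [->//|xy]]; rewrite xy in Ax.
have fM u v : A u -> A v -> f (u * v) = f u * f v.
  by move=> /aA[k ->] /aA[l ->]; rewrite -zpowD !fK.
have fbij : set_bij A setT f.
  split=> [//|u v /set_mem Au /set_mem Av fuv|k _].
    by rewrite (fE u Au) fuv -fE.
  by exists (zpow a k); [apply: subgZ|apply: fK].
have [theta [thM thE thiso]] := isog_sdprod_aut sgA cAA nA CA sgQ AQ AIQ fM fbij.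
rewrite /infinite_dihedral; have <- // : range theta = generated [set Zgroup_inv].
have th_inv g : ~ A g -> theta g = Zgroup_inv.
  move=> Ag; apply: aut_ext => k; rewrite -[k]fK thE; last exact: subgZ.
  rewrite (invA _ (AV _ Ag)); last exact: subgZ.
  by rewrite -zpowN !fK.
apply/seteqP; split.
  move=> _ [g _ <-]; have [Ag|Ag] := pselect (A g); last first.
    by rewrite th_inv //; apply: sub_generated.
  have -> : theta g = 1; last exact: subg1 (generated_subgroup _).
  apply: aut_ext => k; rewrite -[k in LHS]fK thE; last exact: subgZ.
  by rewrite conjg_abelian ?fK //; [apply: subgZ|apply: subgV].
apply: (smallest_sub (C := @is_subgroup _)); first exact: range_subgroup.
by move=> _ ->; exists y => //; apply: th_inv.
Qed.

Section Prufer.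
Variables (p : nat) (c : nat -> G).
Hypotheses (p_pr : prime p) (c_ch : is_chain p c) (AE : A = chain_union c).

Lemma self_centralizing_fixed_socle g : c 1%N ^ g = c 1%N -> ~ A g ->
  p = 2 /\ forall x, A x -> x ^ g = x^-1.
Proof.
move: nA CA; rewrite AE => nU CU c1g Ug.
exact: (frakX_prufer_fixed_socle XG p_pr c_ch nU CU c1g Ug).
Qed.

Let Ac n : A (c n). Proof. by rewrite AE; apply: chain_in. Qed.

Lemma conjg_layer n g : exists k, c n ^ g = c n ^+ k.
Proof.
apply: (chain_layer p_pr c_ch); first by rewrite -AE; apply: nA.
by rewrite -conjXg (iffRL (chain_order p_pr c_ch _ _)) ?conj1g.
Qed.

(** [c 1] is the only element of order 2 in [A], hence fixed by all of [G]; so all elements outside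
    [A] invert [A], their quotients lie in [A], and any of them serves as [y]. *)
Lemma self_centralizing_prufer2 : p = 2 -> A <> setT ->
  exists (B : set G) (y : G),
        [/\ is_subgroup B /\ isog B [set: prufer 2],
            [set: G] = mul_set B (generated [set y]),
            (generated [set y] #= `I_2)%card \/ (generated [set y] #= `I_4)%card,
            B (y ^+ 2)
          & forall a : G, B a -> a ^ y = a^-1].
Proof.
move=> p2 AT.
have c1p : c 1%N ^+ 2 = 1 by rewrite -p2 (chainS c_ch) (chain0 c_ch).
have c11 : c 1%N <> 1 by case: c_ch.
have c1g g : c 1%N ^ g = c 1%N.
  have [k cgE] := conjg_layer 1 g.
  have [[|[|]] // _ kE] := zpow_mod k (isT : (0 < 2)%N) c1p; last by rewrite cgE -[RHS]kE.
  by case: c11; apply/eqP; rewrite -(conjg_eq1 _ g) cgE -[_ ^+ k]/(zpow _ k) kE.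
have invA g : ~ A g -> forall x, A x -> x ^ g = x^-1.
  by move=> Ag; have [] := self_centralizing_fixed_socle (c1g g) Ag.
have [y Ay] : exists y, ~ A y by apply/setTPn/eqP.
have AyV : ~ A y^-1 by move=> AyV; apply: Ay; rewrite -[y]invgK; apply: subgV.
have Ay2 : A (y ^+ 2).
  by rewrite expg2 -{2}[y]invgK; apply: inverting_div => //; apply: invA.
have y4 : y ^+ 4 = 1.
  have E : (y ^+ 2) ^ y = y ^+ 2 by rewrite conjXg /conjg mulKg.
  rewrite -[4]/(2 * 2)%N expgnA expg2 -{1}E invA // mulVg //.
have y1 : y <> 1 by move=> y1; apply: Ay; rewrite y1; apply: subg1.
exists A, y; split=> //.
- split=> //; rewrite -p2; apply: is_prufer_isog (prufer_is_prufer p_pr) => //.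
  by split=> //; exists c.
- apply/seteqP; split=> // g _; have [Ag|Ag] := pselect (A g).
    by exists g => //; exists 1; [exact: subg1 (generated_subgroup _)|rewrite mulg1].
  exists (g / y); first by apply: inverting_div => //; apply: invA.
  by exists y; [apply: sub_generated|rewrite mulgVK].
- have [y2|y2] := pselect (y ^+ 2 = 1); [left|right]; apply: generated_card => //.
    by move=> [|[|]].
  case=> [|[|[|[|]]]] // _ y3; apply: y1.
  by apply: (mulgI (y ^+ 3)); rewrite -expgSr mulg1 y4 y3.
- exact: invA.
Qed.

(** Elements outside [A] move [c 1]. The centralizer [Q] of one of them, [y], is a complement: it
    meets [A] trivially, as [c 1] is a power of each nontrivial element of [A], and commutators with
    [y] exhaust [A]. *)
Lemma self_centralizing_prufer_odd : odd p -> A <> setT ->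
  exists D : set (aut (prufer p)),
    [/\ is_subgroup D, D `<=` @finite_order_auts (prufer p), D <> [set 1]
      & isog [set: G] (sdprod_aut D)].
Proof.
move=> p_odd AT.
have fpf g : c 1%N ^ g = c 1%N -> A g.
  move=> c1g; apply: contrapT => Ag.
  by have [p2] := self_centralizing_fixed_socle c1g Ag; rewrite p2 in p_odd.
have [y Ay] : exists y, ~ A y by apply/setTPn/eqP.
(* Every element acts on [<c n>] as a power map, and power maps commute; hence commutators
   centralize [A]. *)
have conjC g h x : A x -> x ^ (g * h) = x ^ (h * g).
  rewrite AE => -[n [k ->]]; rewrite !conjXg; congr (_ ^+ _).
  have [i iE] := conjg_layer n g; have [j jE] := conjg_layer n h.
  by rewrite !conjgM iE jE !conjXg iE jE expgnAC.
have AR g h : A [~ g, h].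
  apply: self_centralizing_fix => x Ax.
  have -> : [~ g, h] = (h * g)^-1 * (g * h) by rewrite /commg /conjg invgM !mulgA.
  by rewrite conjgM conjC ?conjgKV //; apply: nA.
pose Q := centralizer [set y].
have sgQ : is_subgroup Q := centralizer_subgroup _.
have AIQ : A `&` Q `<=` [set 1].
  move=> x [Ax Qx]; apply: contrapT => x1; apply/Ay/fpf.
  rewrite AE in Ax; have [j ->] := chain_bottom p_pr c_ch Ax x1.
  rewrite conjXg; congr (_ ^+ _); apply/eqP; rewrite conjg_fix; apply/commgP.
  exact: Qx.
have AQ g : exists a q, [/\ A a, Q q & g = a * q].
  (* [phi a] is [[~ y, a]]. This nontrivial endomorphism of [A] is onto, so [[~ y, g] = [~ y, a]]
     for some [a] in [A], and [g / a] centralizes [y]. *)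
  pose phi a := (a^-1) ^ y * a.
  have phiA a : A a -> A (phi a).
    by move=> Aa; apply: (subgM sgA) => //; apply/nA/(subgV sgA).
  have phiM a b : A a -> A b -> phi (a * b) = phi a * phi b.
    move=> Aa Ab; have AaV : A (a^-1 ^ y) by apply/nA/(subgV sgA).
    have AbV : A (b^-1 ^ y) by apply/nA/(subgV sgA).
    have := cAA AbV (phiA a Aa); rewrite /phi invgM conjMg.
    by move: (b^-1 ^ y) (a^-1 ^ y) => b' a' E; rewrite !mulgA -[b' * a' * a]mulgA E.
  have phi_nt : exists2 a, A a & phi a <> 1.
    apply: contrapT => no; apply/Ay/self_centralizing_fix => a Aa.
    apply/esym/(mulgI (a^-1 ^ y)); rewrite -conjMg mulVg conj1g.
    by apply: contrapT => nt; apply: no; exists a.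
  have phi_onto : forall b, A b -> exists2 a, A a & phi a = b.
    move: phiA phiM phi_nt; rewrite AE => UA UM Unt b Ub.
    exact: (chain_endo_onto p_pr c_ch UA UM Unt).
  have [a Aa aE] := phi_onto _ (AR y g).
  have yga : y ^ a = y ^ g.
    apply: (mulgI y^-1); rewrite -!commgEl -aE /phi /commg /conjg.
    by rewrite !mulgA.
  have Qga : Q (g / a).
    move=> _ ->; apply/commute_sym/commgP; rewrite -conjg_fix conjgM -yga.
    by rewrite -conjgM mulgV conjg1.
  exists (a ^ (g / a)^-1), (g / a); split=> //; first exact: nA.
  by rewrite -conjgCV mulgVK.
have [f [fM fbij]] : isog A [set: prufer p].
  by apply: is_prufer_isog (prufer_is_prufer p_pr) => //; split=> //; exists c.
have [theta [thM thE thiso]] := isog_sdprod_aut sgA cAA nA CA sgQ AQ AIQ fM fbij.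
have th1 g : A g -> theta g = 1.
  move=> Ag; apply: aut_ext => b; have [a Aa <-] : exists2 a, A a & f a = b.
    by case: fbij => _ _ /(_ b I)[a Aa ab]; exists a.
  by rewrite thE // conjg_abelian //; apply: subgV.
have thX g n : theta (g ^+ n) = theta g ^+ n.
  elim: n => [|n IHn]; first by rewrite !expg0 th1 //; apply: subg1.
  by rewrite !expgS thM IHn.
exists (range theta); split=> //.
- exact: range_subgroup.
(* By Fermat, [k ^ p] is [k] modulo [p], so [g ^+ p] and [g] agree on [c 1]; thus [g ^+ p.-1] fixes
   [c 1] and lies in [A]. *)
- move=> _ [g _ <-]; exists p.-1; first by have := prime_gt1 p_pr; lia.
  rewrite -thX; apply/th1/fpf; apply: (conjg_inj g).
  rewrite -conjgM -expgSr prednK ?prime_gt0 //.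
  have [k kE] := conjg_layer 1 g.
  have gX n : c 1%N ^ (g ^+ n) = c 1%N ^+ (k ^ n).
    elim: n => [|n IHn]; first by rewrite conjg1.
    by rewrite expgSr conjgM IHn conjXg kE -expgnA expnS.
  by rewrite gX kE; apply/(chain_expg_eq p_pr _ _ _ c_ch); rewrite expn1 fermat_little.
move=> D1; have ty : theta y = 1.
  by have : range theta (theta y) by []; rewrite D1.
apply/Ay/self_centralizing_fix => a Aa; apply: (conjg_inj y^-1); rewrite conjgK.
case: fbij => _ finj _; apply: finj; rewrite ?inE //; first exact: nA.
by rewrite -thE // ty.
Qed.

End Prufer.

End FrakXForward.

(** * From the listed families back to the $\mathfrak X$ property *)

Lemma infinite_dihedral_frakX (G : groupType) :
  isog [set: G] infinite_dihedral -> frakX_group G.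
Proof.
have sgD := generated_subgroup [set Zgroup_inv].
have cZ (x y : Zgroup) : commute x y by apply: (@addrC int).
case/(sdprod_aut_action cZ sgD) => e [theta [[eI eM] thM thD thE thA]].
have e1 : e 1 = 1 by apply: (mulgI (e 1)); rewrite -eM !mulg1.
have sgA : is_subgroup (range e) := range_subgroup eM.
(* In [Zgroup] the identity [1] is the integer 0, whereas [1%R : int] is a generator. *)
have eZ k : e k = zpow (e (1%R : int)) k.
  elim/int_up_down: k => [//|k]; rewrite zpowS.
  by rewrite (eM k 1%R); split=> [->//|/mulIg].
have eX2 x : e x ^+ 2 = e (x * x) by rewrite expg2 eM.
have sq1 k : e k ^+ 2 = 1 -> e k = 1.
  rewrite eX2 -{1}e1 => /eI kk; have kk0 : ((k : int) + k = 0)%R by [].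
  by have -> : k = (0%R : int) by lia.
apply: (frakX_inverted sgA) => [g Ag _ [b _ <-]|H sgH HA Hnc|_ b [k _ <-] _ /sq1 -> _|].
- have AgV : ~ range e g^-1 by move=> AgV; apply: Ag; rewrite -[g]invgK; apply: subgV.
  have tV : theta g^-1 = Zgroup_inv.
    by apply: generated_Zgroup_inv => // /thA.
  rewrite -{1}[g]invgK thE tV; apply/esym/mulg1_eq; rewrite -eM.
  by rewrite mulgV e1.
- case: Hnc; apply: (@subgroup_of_cyclic _ _ (e (1%R : int))) => // x /HA[k _ <-].
  by exists k; rewrite -?eZ.
- by exists 0%R.
- exists (e (1%R : int)); first by exists (1%R : int).
  by rewrite eX2 -e1 => /eI.
Qed.

Lemma generalized_dihedral_frakX (G : groupType) (A : set G) (y : G) :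
  is_subgroup A -> isog A [set: prufer 2] ->
  [set: G] = mul_set A (generated [set y]) -> A (y ^+ 2) ->
  (forall a : G, A a -> a ^ y = a^-1) -> frakX_group G.
Proof.
move=> sgA isoA AyT Ay2 yA; have p_pr : prime 2 by [].
have [_ [c c_ch AE]] := isog_is_prufer p_pr sgA isoA (prufer_is_prufer p_pr).
apply: (frakX_inverted sgA) => [g Ag|H sgH|a b|].
- have : [set: G] g by [].
  rewrite AyT generated1E => -[a Aa [_ [k _ <-] gE]] x Ax.
  have ax : x ^ a = x.
    by apply/eqP; rewrite conjg_fix; apply/commgP; rewrite AE in Ax Aa; apply: (chain_abelian c_ch).
  (* Even powers of [y] lie in the abelian group [A] and act trivially on it, so only the parity of
     the exponent matters. *)
  have [j [r [r2 kE]]] : exists j r, (r < 2)%N /\ k = (2%:Z * j + r%:Z)%R.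
    exists (k %/ 2)%Z, `|(k %% 2)%Z|%N; split; first by lia.
    by lia.
  have Aj : A (zpow y (2%:Z * j)%R) by rewrite zpowM; apply: (subgZ j sgA).
  move: r2 kE; case: r => [|[|]] // _ kE.
    by case: Ag; rewrite -gE kE addr0; apply: (subgM sgA).
  rewrite -gE kE zpowD !conjgM ax.
  have -> : x ^ zpow y (2%:Z * j)%R = x.
    apply/eqP; rewrite conjg_fix; apply/commgP; rewrite AE in Ax Aj; exact: (chain_abelian c_ch).
  exact: yA.
- by rewrite AE; apply: (chain_min_noncyclic p_pr c_ch sgH).
- rewrite AE => Ua Ub a2 b1; have [j cE] := chain_bottom p_pr c_ch Ub b1.
  have [k ->] := chain_layer (n := 1) p_pr c_ch Ua a2.
  by exists (j * k)%N; rewrite cE /= expgnA.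
- exists (c 2%N); first by rewrite AE; apply: chain_in.
  by rewrite (chainS c_ch 1); case: c_ch.
Qed.

(** For [p] odd, an automorphism of finite order fixing the socle is trivial, by
    [fixes_finite_order]; so elements outside the base group move [c 1] and [frakX_frobenius]
    applies. *)
Lemma sdprod_prufer_frakX (G : groupType) p (D : set (aut (prufer p))) :
  prime p -> odd p -> is_subgroup D -> D `<=` @finite_order_auts (prufer p) ->
  isog [set: G] (sdprod_aut D) -> frakX_group G.
Proof.
move=> p_pr p_odd sgD Dfin.
have [_ [d d_ch dT]] := prufer_is_prufer p_pr.
have cP (x y : prufer p) : commute x y by apply: (chain_abelian d_ch); rewrite -dT.
case/(sdprod_aut_action cP sgD) => e [theta [[eI eM] thM thD thE thA]].
have e1 : e 1 = 1 by apply: (mulgI (e 1)); rewrite -eM !mulg1.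
have eX x n : e (x ^+ n) = e x ^+ n.
  by elim: n => [//|n IHn]; rewrite !expgS eM IHn.
have th1 : theta 1 = 1 by apply: (mulgI (theta 1)); rewrite -thM !mulg1.
have thX g n : theta (g ^+ n) = theta g ^+ n.
  by elim: n => [//|n IHn]; rewrite !expgS thM IHn.
pose c n := e (d n).
have c_ch : is_chain p c.
  case: d_ch => d0 d1 dS; split=> [|c1|n]; first by rewrite /c d0.
    by apply: d1; apply: eI; rewrite e1.
  by rewrite /c -eX dS.
have UE : chain_union c = range e.
  apply/seteqP; split=> [_ [n [k ->]]|_ [b _ <-]].
    by exists (d n ^+ k) => //; rewrite eX.
  have : [set: prufer p] b by [].
  by rewrite dT => -[n [k ->]]; exists n, k; rewrite eX.
have nU : normal_set (chain_union c).
  rewrite UE => _ g [b _ <-]; exists (theta g^-1 b) => //.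
  by rewrite -thE invgK.
apply: (frakX_frobenius p_pr c_ch nU) => g Ug c1g; apply: Ug; rewrite UE; apply/thA.
have [n n0 gn] := Dfin _ (thD g).
have gfix : forall x, chain_union c x -> x ^ g = x.
  apply: (fixes_finite_order p_pr c_ch n0 (fun x => nU x g)).
    by split=> //; left.
  (* [theta g] has finite order, so a power of [g] lies in the abelian base group and acts trivially
     on it. *)
  have [b _ gE] : range e (g ^+ n) by apply/thA; rewrite thX gn.
  rewrite UE => _ [b' _ <-]; rewrite -gE; apply/eqP; rewrite conjg_fix.
  by apply/commgP; rewrite /commute -!eM cP.
apply: aut_ext => b; apply: eI; rewrite -thE.
by apply: (conjg_inj g); rewrite conjgKV gfix // UE; exists b.
Qed.

Theorem theorem3p6 (G : groupType)
    (G_infinite : infinite_set [set: G]) (G_soluble : soluble G) :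
  frakX_group G <->
  (is_cyclic [set: G]
   \/ (exists p : nat, prime p /\ isog [set: G] [set: prufer p])
   \/ isog [set: G] infinite_dihedral
   \/ (exists (A : set G) (y : G),
        [/\ is_subgroup A /\ isog A [set: prufer 2],
            [set: G] = mul_set A (generated [set y]),
            (generated [set y] #= `I_2)%card \/ (generated [set y] #= `I_4)%card,
            A (y ^+ 2)
          & forall a : G, A a -> a ^ y = a^-1])
   \/ (exists (p : nat) (D : set (aut (prufer p))),
        [/\ prime p /\ odd p,
            is_subgroup D,
            D `<=` @finite_order_auts (prufer p),
            D <> [set 1]
          & isog [set: G] (sdprod_aut D)])).
Proof.
split.
  move=> XG; have [A [sgA nA cAA Ainf CA]] := frakX_self_centralizing XG G_infinite G_soluble.
  have [Ac|Anc] := pselect (is_cyclic A).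
    have [AT|AT] := pselect (A = setT); first by left; rewrite -AT.
    by right; right; left; apply: (self_centralizing_cyclic sgA nA cAA Ainf CA).
  have [p [p_pr [c c_ch AE]]] := frakX_abelian_infinite XG sgA cAA Ainf Anc.
  have [AT|AT] := pselect (A = setT).
    right; left; exists p; split=> //; rewrite -AT.
    by apply: is_prufer_isog (prufer_is_prufer p_pr) => //; split=> //; exists c.
  do 3!right; have [p2|p_odd] := even_prime p_pr; [left|right].
    exact: (self_centralizing_prufer2 XG sgA nA CA p_pr c_ch AE p2 AT).
  have [D [sgD Dfin D1 iso]] :=
    self_centralizing_prufer_odd XG sgA nA cAA CA p_pr c_ch AE p_odd AT.
  by exists p, D; split.
case=> [Gc|[[p [p_pr iso]]|[iso|[]]]]; [| | |case=> A|case=> p].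
- move=> H sgH []; have [x GE] := Gc.
  by apply: (@subgroup_of_cyclic _ _ x) => //; rewrite -generated1E -GE.
- have sgT : is_subgroup [set: G] by split.
  have [_ [c c_ch TE]] := isog_is_prufer p_pr sgT iso (prufer_is_prufer p_pr).
  move=> H sgH Hnc x _; rewrite (chain_min_noncyclic p_pr c_ch sgH _ Hnc) -TE //.
- exact: infinite_dihedral_frakX.
- by case=> y [[sgA isoA] AyT _ Ay2 yA]; apply: generalized_dihedral_frakX yA.
- by case=> D [[p_pr p_odd] sgD Dfin _ iso]; apply: sdprod_prufer_frakX iso.
Qed.
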